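(* For every measure $\mu$, the (real or complex) space $L_\infty(\mu)$ has the BPBp-nu for compact operators.
   Context: Banach spaces are over $\mathbb{K}=\mathbb{R}$ or $\mathbb{C}$. For a Banach space $X$, $S_X$ is its unit sphere, $X^*$ its dual, $\mathcal{K}(X)$ the space of compact linear operators from $X$ to $X$, and $\Pi(X)=\{(x,x^* )\in S_X\times S_{X^*}: x^*(x)=1\}$. The numerical radius of a bounded linear operator $T$ on $X$ is $\nu(T)=\sup\{|x^*(T(x))|:(x,x^* )\in\Pi(X)\}$. A Banach space $X$ has the Bishop-Phelps-Bollobás property for numerical radius for compact operators (BPBp-nu for compact operators) if for every $0<\varepsilon<1$ there exists $\eta(\varepsilon)\in(0,1)$ such that whenever $T\in\mathcal{K}(X)$ and $(x,x^* )\in\Pi(X)$ satisfy $\nu(T)=1$ and $|x^*(T(x))|>1-\eta(\varepsilon)$, there exist $S\in\mathcal{K}(X)$ and $(y,y^* )\in\Pi(X)$ such that $\nu(S)=|y^*(S(y))|=1$, $\|T-S\|<\varepsilon$, $\|x-y\|<\varepsilon$ and $\|x^*-y^*\|<\varepsilon$. *)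

(* Defs.v *)
Set Warnings "-all".
From HB Require Import structures.
From mathcomp Require Import all_boot all_order all_algebra generic_quotient.
From mathcomp Require Import ring_quotient complex.
From mathcomp Require Import all_classical all_reals all_analysis measurable_realfun ess_sup_inf.
Set Implicit Arguments.
Unset Strict Implicit.
Unset Printing Implicit Defensive.
Import Order.TTheory GRing.Theory Num.Theory.
Import numFieldNormedType.Exports.
Local Open Scope classical_set_scope.
Local Open Scope ring_scope.

Variant scalar_kind := RealScalars | ComplexScalars.

Definition scalar_field (R : realType) (k : scalar_kind) : numFieldType :=
  match k with RealScalars => R | ComplexScalars => R[i] end.

Section scalar_field.
Context (R : realType) (k : scalar_kind).
Local Notation K := (scalar_field R k).

Definition scalar_re : K -> R :=
  match k return scalar_field R k -> R with
  | RealScalars => fun x => x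
  | ComplexScalars => fun z : R[i] => complex.Re z
  end.

Definition scalar_im : K -> R :=
  match k return scalar_field R k -> R with
  | RealScalars => fun=> 0
  | ComplexScalars => fun z : R[i] => complex.Im z
  end.

Definition scalar_of : R -> K :=
  match k return R -> scalar_field R k with
  | RealScalars => fun x => x
  | ComplexScalars => fun x => real_complex R x
  end.

(* The norm of [K] takes its values in [K]; this is the same norm, in [R]. *)
Definition modulus (z : K) : R := scalar_re `|z|.

End scalar_field.

Section scalar_theory.
Context (R : realType) (k : scalar_kind).
Local Notation K := (scalar_field R k).
Implicit Types z w : K.

Lemma scalar_re0 : scalar_re (0 : K) = 0. Proof. by case: k. Qed.

Lemma scalar_im0 : scalar_im (0 : K) = 0. Proof. by case: k. Qed.

Lemma scalar_reD z w : scalar_re (z + w) = scalar_re z + scalar_re w.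
Proof. by case: k z w => //= -[? ?] []. Qed.

Lemma scalar_imD z w : scalar_im (z + w) = scalar_im z + scalar_im w.
Proof. by case: k z w => [? ?|[? ?] []]//=; rewrite addr0. Qed.

Lemma scalar_reM z w :
  scalar_re (z * w) = scalar_re z * scalar_re w - scalar_im z * scalar_im w.
Proof. by case: k z w => [? ?|[? ?] []]//=; rewrite mulr0 subr0. Qed.

Lemma scalar_imM z w :
  scalar_im (z * w) = scalar_re z * scalar_im w + scalar_im z * scalar_re w.
Proof. by case: k z w => [? ?|[? ?] []]//=; rewrite mulr0 mul0r addr0. Qed.

Lemma scalar_of0 : scalar_of k (0 : R) = 0. Proof. by case: k. Qed.

Lemma scalar_ofD (x y : R) : scalar_of k (x + y) = scalar_of k x + scalar_of k y.
Proof. by case: k => //=; rewrite rmorphD. Qed.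

Lemma scalar_ofM (x y : R) : scalar_of k (x * y) = scalar_of k x * scalar_of k y.
Proof. by case: k => //=; rewrite rmorphM. Qed.

Lemma scalar_of_le (x y : R) : (scalar_of k x <= scalar_of k y) = (x <= y).
Proof. by case: k => //=; rewrite lecR. Qed.

Lemma scalar_of_lt (x y : R) : (scalar_of k x < scalar_of k y) = (x < y).
Proof. by case: k => //=; rewrite ltcR. Qed.

Lemma scalar_of_inj : injective (@scalar_of R k).
Proof. by case: k => //= x y []. Qed.

Lemma modulusE z : `|z| = scalar_of k (modulus z).
Proof. by rewrite /modulus; case: k z => //= -[a b]. Qed.

Lemma modulus_ge0 z : 0 <= modulus z.
Proof. by rewrite -scalar_of_le -modulusE scalar_of0. Qed.

Lemma modulus0 : modulus (0 : K) = 0.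
Proof. by rewrite /modulus normr0 scalar_re0. Qed.

Lemma modulus_eq0 z : modulus z = 0 -> z = 0.
Proof. by move=> z0; apply/eqP; rewrite -normr_eq0 modulusE z0 scalar_of0. Qed.

Lemma modulusD z w : modulus (z + w) <= modulus z + modulus w.
Proof. by rewrite -scalar_of_le scalar_ofD -!modulusE ler_normD. Qed.

Lemma modulusM z w : modulus (z * w) = modulus z * modulus w.
Proof. by apply: scalar_of_inj; rewrite scalar_ofM -!modulusE normrM. Qed.

Definition scalar_mk (a b : R) : K :=
  match k return scalar_field R k with
  | RealScalars => a
  | ComplexScalars => (a +i* b)%C
  end.

Lemma scalar_re_mk a b : scalar_re (scalar_mk a b) = a.
Proof. by rewrite /scalar_mk; case: k. Qed.

Lemma scalar_im_mk a b (z : K) : `|scalar_im (z - scalar_mk a b)| <= `|scalar_im z - b|.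
Proof. by rewrite /scalar_mk; case: k z => [z|[x y]]//=; rewrite normr0. Qed.

Lemma scalar_im_mk_meas d (T : measurableType d) (f g : T -> R) :
  measurable_fun setT g ->
  measurable_fun setT (fun x => scalar_im (scalar_mk (f x) (g x))).
Proof. by rewrite /scalar_mk; case: k. Qed.

Lemma scalar_reB (z w : K) : scalar_re (z - w) = scalar_re z - scalar_re w.
Proof. by case: k z w => //= -[? ?] []. Qed.

Lemma scalar_imB (z w : K) : scalar_im (z - w) = scalar_im z - scalar_im w.
Proof. by case: k z w => [? ?|[? ?] []]//=; rewrite subr0. Qed.

Lemma scalar_re_le (z : K) : `|scalar_re z| <= modulus z.
Proof.
rewrite /modulus; case: k z => //= -[a b] /=.
by rewrite -sqrtr_sqr ler_wsqrtr// lerDl sqr_ge0.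
Qed.

Lemma scalar_im_le (z : K) : `|scalar_im z| <= modulus z.
Proof.
rewrite /modulus; case: k z => [z|[a b]] /=; first by rewrite normr0.
by rewrite -sqrtr_sqr ler_wsqrtr// lerDr sqr_ge0.
Qed.

Lemma modulus_le (z : K) : modulus z <= `|scalar_re z| + `|scalar_im z|.
Proof.
rewrite /modulus; case: k z => [z|[a b]] /=; first by rewrite normr0 addr0.
rewrite -[leRHS]ger0_norm ?addr_ge0// -sqrtr_sqr ler_wsqrtr//.
rewrite sqrrD !real_normK ?num_real// addrAC lerDl.
by rewrite mulrn_wge0// mulr_ge0.
Qed.

End scalar_theory.

Lemma cauchy_harmonic (R : realType) (a : nat -> R) :
  (forall n m, `|a n - a m| <= n.+1%:R^-1 + m.+1%:R^-1) ->
  exists2 l, a @ \oo --> l & forall n, `|a n - l| <= n.+1%:R^-1.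
Proof.
move=> aP; have ca : cvg (a @ \oo).
  apply: cauchy_cvg; apply: cauchy_exP => e e0.
  have e20 : 0 < e / 2 by rewrite divr_gt0.
  near \oo => N; exists (a N).
  change (\forall n \near \oo, ball (a N) e (a n)); near=> n.
  apply: (le_lt_trans (aP _ _)); rewrite (splitr e) ltrD//.
    by near: N; exact: (near_infty_natSinv_lt (PosNum e20)).
  by near: n; exact: (near_infty_natSinv_lt (PosNum e20)).
exists (lim (a @ \oo)) => // n; apply/ler_addgt0Pr => e e0.
have e20 : 0 < e / 2 by rewrite divr_gt0.
near \oo => m.
rewrite -(subrK (a m) (a n)) -addrA (le_trans (ler_normD _ _))//.
rewrite [e]splitr addrA lerD//.
  rewrite (le_trans (aP _ _))// lerD2l ltW//.
  by near: m; exact: (near_infty_natSinv_lt (PosNum e20)).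
by rewrite distrC; near: m; exact: cvgr_dist_le.
Unshelve. all: by end_near. Qed.

Section Linfty.
Context (R : realType) (k : scalar_kind).
Context d (T : measurableType d) (mu : {measure set T -> \bar R}).
Local Notation K := (scalar_field R k).

(* [Lnorm mu +oo] is the essential supremum, with value 0 if [mu] is zero. *)
Definition Linfty_norm (f : T -> K) : \bar R :=
  Lnorm mu +oo%E (fun x => (modulus (f x))%:E).

Lemma Linfty_norm_ge0 f : (0 <= Linfty_norm f)%E.
Proof. exact: Lnorm_ge0. Qed.

Lemma Linfty_normP f (c : R) : 0 <= c ->
  (Linfty_norm f <= c%:E)%E <-> (\forall x \ae mu, modulus (f x) <= c).
Proof.
move=> c0; rewrite /Linfty_norm unlock; case: ifPn => muT.
  split.
    move=> /ess_supP; apply: filterS => x /=.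
    by rewrite lee_fin ger0_norm ?modulus_ge0.
  move=> fc; apply/ess_supP; apply: filterS fc => x /=.
  by rewrite lee_fin ger0_norm ?modulus_ge0.
rewrite lee_fin c0; split=> // _.
have {}muT : mu [set: T] = 0 by apply/eqP; rewrite eq_le measure_ge0 leNgt muT.
by exists setT; split.
Qed.

(* A complex function is measurable when its real and imaginary parts are. *)
Definition is_Linfty_fun (f : T -> K) : Prop :=
  [/\ measurable_fun setT (fun x => scalar_re (f x)),
      measurable_fun setT (fun x => scalar_im (f x))
    & (Linfty_norm f < +oo)%E].

Lemma Linfty_norm_finP f : (Linfty_norm f < +oo)%E <->
  exists2 c : R, 0 <= c & \forall x \ae mu, modulus (f x) <= c.
Proof.
split=> [foo|[c c0 fc]]; last first.
  by apply: (@le_lt_trans _ _ c%:E); [exact/Linfty_normP|rewrite ltry].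
have ffin : Linfty_norm f \is a fin_num by rewrite ge0_fin_numE// Linfty_norm_ge0.
exists (fine (Linfty_norm f)); first by rewrite fine_ge0// Linfty_norm_ge0.
by apply/Linfty_normP; rewrite ?fine_ge0 ?Linfty_norm_ge0// fineK.
Qed.

Definition Linfty_pred : {pred T -> K} := fun f => `[< is_Linfty_fun f >].

Lemma Linfty_pred_submod : submod_closed Linfty_pred.
Proof.
split.
  apply/asboolP; split.
  - by rewrite [X in measurable_fun _ X](_ : _ = cst 0)//; apply/funext => x;
       exact: scalar_re0.
  - by rewrite [X in measurable_fun _ X](_ : _ = cst 0)//; apply/funext => x;
       exact: scalar_im0.
  - by apply/Linfty_norm_finP; exists 0 => //; apply: aeW => x; rewrite /= modulus0.
move=> a f g /asboolP[fr fi /Linfty_norm_finP[c c0 fc]].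
move=> /asboolP[gr gi /Linfty_norm_finP[e e0 ge]]; apply/asboolP; split.
- under eq_fun do rewrite -[X in scalar_re X]/(a * f _ + g _) scalar_reD scalar_reM.
  apply: measurable_funD => //; apply: measurable_funB;
    exact: measurable_funM.
- under eq_fun do rewrite -[X in scalar_im X]/(a * f _ + g _) scalar_imD scalar_imM.
  apply: measurable_funD => //; apply: measurable_funD;
    exact: measurable_funM.
- apply/Linfty_norm_finP; exists (modulus a * c + e).
    by rewrite addr_ge0// mulr_ge0 ?modulus_ge0.
  apply: filterS2 fc ge => x fc ge.
  rewrite (le_trans (modulusD _ _))// lerD// modulusM.
  by rewrite ler_wpM2l ?modulus_ge0.
Qed.

HB.instance Definition _ :=
  GRing.isSubmodClosed.Build K (T -> K) Linfty_pred Linfty_pred_submod.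

Definition Linfty_fun : Type := {f : T -> K | f \in Linfty_pred}.

HB.instance Definition _ := SubType.on Linfty_fun.
HB.instance Definition _ := Choice.on Linfty_fun.
HB.instance Definition _ := [SubChoice_isSubLmodule of Linfty_fun by <:].

Definition Linfty_null : {pred Linfty_fun} :=
  fun f => `[< val f = cst 0 %[ae mu] >].

Lemma Linfty_null_submod : submod_closed Linfty_null.
Proof.
split; first by apply/asboolP; exact: aeW.
move=> a f g /asboolP f0 /asboolP g0; apply/asboolP.
apply: filterS2 f0 g0 => x /(_ I) f0 /(_ I) g0 _.
by rewrite -[LHS]/(a * val f x + val g x) f0 g0 /cst mulr0 addr0.
Qed.

HB.instance Definition _ :=
  GRing.isSubmodClosed.Build K Linfty_fun Linfty_null Linfty_null_submod.


Local Open Scope quotient_scope.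

Definition Linfty : Type := {ideal_quot Linfty_null}.

HB.instance Definition _ := Choice.on Linfty.
HB.instance Definition _ := EqQuotient.on Linfty.
HB.instance Definition _ := GRing.Zmodule.on Linfty.
HB.instance Definition _ := ZmodQuotient.on Linfty.

Lemma Linfty_eqP (f g : Linfty_fun) :
  \pi_Linfty f = \pi_Linfty g <-> val f = val g %[ae mu].
Proof.
have -> : \pi_Linfty f = \pi_Linfty g <-> Linfty_null (f - g).
  by split=> [fg|fg]; [apply: (etrans (Quotient.idealrBE Linfty_null f g)); apply/eqP
                      |apply/eqP; rewrite -Quotient.idealrBE].
split=> [/asboolP fg|fg]; last apply/asboolP; apply: filterS fg => x /(_ I).
  by rewrite -[val (f - g) x]/(val f x - val g x) => /eqP;
    rewrite subr_eq0 => /eqP.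
by rewrite -[val (f - g) x]/(val f x - val g x) => ->; rewrite subrr.
Qed.

Lemma Linfty_reprP (f : Linfty_fun) :
  val (repr (\pi_Linfty f)) = val f %[ae mu].
Proof. by apply/Linfty_eqP; rewrite reprK. Qed.

Lemma Linfty_piD (f g : Linfty_fun) :
  \pi_Linfty (f + g) = \pi_Linfty f + \pi_Linfty g.
Proof. exact: pi_addr. Qed.

Definition Linfty_scale (a : K) (u : Linfty) : Linfty := \pi_Linfty (a *: repr u).

Lemma Linfty_scale_pi a (f : Linfty_fun) :
  Linfty_scale a (\pi_Linfty f) = \pi_Linfty (a *: f).
Proof.
apply/Linfty_eqP; apply: filterS (Linfty_reprP f) => x /(_ I) fx _.
by rewrite -[LHS]/(a * val (repr (\pi_Linfty f)) x) fx.
Qed.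

Lemma Linfty_scaleA a b u :
  Linfty_scale a (Linfty_scale b u) = Linfty_scale (a * b) u.
Proof.
by rewrite -[u]reprK (Linfty_scale_pi b) !Linfty_scale_pi scalerA.
Qed.

Lemma Linfty_scale1 : left_id 1 Linfty_scale.
Proof. by move=> u; rewrite -[u]reprK Linfty_scale_pi scale1r. Qed.

Lemma Linfty_scaleDr : right_distributive Linfty_scale +%R.
Proof.
move=> a u v; rewrite -[u]reprK -[v]reprK -Linfty_piD !Linfty_scale_pi.
by rewrite scalerDr Linfty_piD.
Qed.

Lemma Linfty_scaleDl u : {morph Linfty_scale^~ u : a b / a + b}.
Proof.
by move=> a b; rewrite -[u]reprK !Linfty_scale_pi scalerDl Linfty_piD.
Qed.

HB.instance Definition _ := GRing.Zmodule_isLmodule.Build K Linfty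
  Linfty_scaleA Linfty_scale1 Linfty_scaleDr Linfty_scaleDl.

Definition Linfty_normK (u : Linfty) : K :=
  scalar_of k (fine (Linfty_norm (val (repr u)))).

Lemma Linfty_fin (f : Linfty_fun) : Linfty_norm (val f) \is a fin_num.
Proof.
have /asboolP[_ _ foo] : Linfty_pred (val f) := valP f.
by rewrite ge0_fin_numE// Linfty_norm_ge0.
Qed.

Lemma fine_Linfty_ge0 f : 0 <= fine (Linfty_norm f).
Proof. by rewrite fine_ge0// Linfty_norm_ge0. Qed.

Lemma Linfty_fineP (f : Linfty_fun) (c : R) : 0 <= c ->
  fine (Linfty_norm (val f)) <= c <-> (\forall x \ae mu, modulus (val f x) <= c).
Proof.
by move=> c0; rewrite -lee_fin fineK ?Linfty_fin//; exact: Linfty_normP.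
Qed.

Lemma Linfty_fine_ae (f : Linfty_fun) :
  \forall x \ae mu, modulus (val f x) <= fine (Linfty_norm (val f)).
Proof. by apply/Linfty_fineP => //; exact: fine_Linfty_ge0. Qed.

Lemma Linfty_normK_pi (f : Linfty_fun) :
  Linfty_normK (\pi_Linfty f) = scalar_of k (fine (Linfty_norm (val f))).
Proof.
congr scalar_of; apply/eqP; rewrite eq_le; apply/andP; split.
  apply/Linfty_fineP; first exact: fine_Linfty_ge0.
  apply: filterS2 (Linfty_reprP f) (Linfty_fine_ae f) => x /(_ I) -> fx; exact: fx.
apply/Linfty_fineP; first exact: fine_Linfty_ge0.
apply: filterS2 (Linfty_reprP f) (Linfty_fine_ae _) => x /(_ I) <- fx; exact: fx.
Qed.

Lemma Linfty_normKD u v :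
  Linfty_normK (u + v) <= Linfty_normK u + Linfty_normK v.
Proof.
rewrite -[u]reprK -[v]reprK -Linfty_piD !Linfty_normK_pi -scalar_ofD scalar_of_le.
set f := repr u; set g := repr v.
apply/Linfty_fineP; first by rewrite addr_ge0// fine_Linfty_ge0.
apply: filterS2 (Linfty_fine_ae f) (Linfty_fine_ae g) => x fx gx.
rewrite -[val (f + g) x]/(val f x + val g x).
by rewrite (le_trans (modulusD _ _))// lerD.
Qed.

Lemma Linfty_normKZ_le a u : Linfty_normK (a *: u) <= `|a| * Linfty_normK u.
Proof.
rewrite -[u]reprK -[_ *: _]/(Linfty_scale _ _) Linfty_scale_pi !Linfty_normK_pi.
rewrite modulusE -scalar_ofM scalar_of_le; set f := repr u.
apply/Linfty_fineP; first by rewrite mulr_ge0 ?modulus_ge0 ?fine_Linfty_ge0.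
apply: filterS (Linfty_fine_ae f) => x fx.
by rewrite -[val (a *: f) x]/(a * val f x) modulusM ler_wpM2l ?modulus_ge0.
Qed.

Lemma Linfty_normK_ge0 u : 0 <= Linfty_normK u.
Proof. by rewrite -(scalar_of0 R k) scalar_of_le fine_Linfty_ge0. Qed.

Lemma Linfty_normKZ a u : Linfty_normK (a *: u) = `|a| * Linfty_normK u.
Proof.
apply: le_anti; rewrite Linfty_normKZ_le /=.
have [->|a0] := eqVneq a 0.
  by rewrite normr0 mul0r Linfty_normK_ge0.
rewrite -[u in X in X <= _](scalerK a0) -ler_pdivlMl ?normr_gt0//.
by rewrite -normfV Linfty_normKZ_le.
Qed.

Lemma Linfty_normK_eq0 u : Linfty_normK u = 0 -> u = 0.
Proof.
rewrite -[u]reprK Linfty_normK_pi -(scalar_of0 R k) => /scalar_of_inj u0.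
have -> : 0 = \pi_Linfty 0 by rewrite [RHS]pi_zeror.
apply/Linfty_eqP.
apply: filterS (Linfty_fine_ae (repr u)) => x; rewrite u0 => ux _.
by apply: modulus_eq0; apply/le_anti; rewrite ux modulus_ge0.
Qed.

HB.instance Definition _ := @Lmodule_isNormed.Build K Linfty Linfty_normK
  Linfty_normKD Linfty_normKZ Linfty_normK_eq0.

Lemma Linfty_complete (F : set_system Linfty) :
  ProperFilter F -> cauchy F -> cvg F.
Proof.
move=> FF /cauchyP Fc.
pose h n : R := n.+1%:R^-1.
have h0 n : 0 < h n by rewrite /h invr_gt0.
have hK n : 0 < scalar_of k (h n) by rewrite -(scalar_of0 R k) scalar_of_lt.
have /choice[u uP] n : exists u, F (ball u (scalar_of k (h n))) by exact: Fc.
pose f n : T -> K := val (repr (u n)).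
have mf n : is_Linfty_fun (f n).
  by apply/asboolP; exact: (valP (repr (u n))).
have fnm : \forall x \ae mu, forall n m, modulus (f n x - f m x) <= h n + h m.
  apply: ae_foralln => n; apply: ae_foralln => m.
  have /filter_ex[v [nv mv]] := @filterI _ F FF _ _ (uP n) (uP m).
  move: nv mv; rewrite -ball_normE /= => nv mv.
  have : `|u n - u m| <= scalar_of k (h n + h m).
    rewrite -(subrK v (u n)) -addrA (le_trans (ler_normD _ _))// scalar_ofD.
    by rewrite lerD// ltW// distrC.
  rewrite -[X in X - _]reprK -[X in _ - X]reprK.
  have -> : \pi_Linfty (repr (u n)) - \pi_Linfty (repr (u m)) =
            \pi_Linfty (repr (u n) - repr (u m)).
    by rewrite -pi_oppr -pi_addr.
  rewrite -[`|_|]/(Linfty_normK _) Linfty_normK_pi scalar_of_le.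
  by move=> /Linfty_fineP; apply; rewrite addr_ge0// ltW.
case: fnm => N [mN muN /subsetCl Nf].
pose A := ~` N; have mA : measurable A by exact: measurableC.
pose re n x := \1_A x * scalar_re (f n x).
pose im n x := \1_A x * scalar_im (f n x).
have fA n m x : x \in A -> modulus (f n x - f m x) <= h n + h m.
  by rewrite inE => /Nf; exact.
have reP x : exists2 l, re ^~ x @ \oo --> l & forall n, `|re n x - l| <= h n.
  apply: cauchy_harmonic => n m; rewrite /re -mulrBr -scalar_reB indicE.
  case: (boolP (x \in A)) => xA; last by rewrite mul0r normr0 addr_ge0// ltW.
  by rewrite mul1r (le_trans (scalar_re_le _))// fA.
have imP x : exists2 l, im ^~ x @ \oo --> l & forall n, `|im n x - l| <= h n.
  apply: cauchy_harmonic => n m; rewrite /im -mulrBr -scalar_imB indicE.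
  case: (boolP (x \in A)) => xA; last by rewrite mul0r normr0 addr_ge0// ltW.
  by rewrite mul1r (le_trans (scalar_im_le _))// fA.
have /choice[a aP] x : exists l, re ^~ x @ \oo --> l /\ forall n, `|re n x - l| <= h n.
  by have [l ? ?] := reP x; exists l.
have /choice[b bP] x : exists l, im ^~ x @ \oo --> l /\ forall n, `|im n x - l| <= h n.
  by have [l ? ?] := imP x; exists l.
pose g x : K := scalar_mk k (a x) (b x).
have fg : forall n, \forall x \ae mu, modulus (f n x - g x) <= h n + h n.
  move=> n; exists N; split => //; apply: subsetCl => x xA /=.
  rewrite (le_trans (modulus_le _))// lerD//.
    rewrite scalar_reB scalar_re_mk; have := (aP x).2 n.
    by rewrite /re indicE mem_set// mul1r.
  rewrite (le_trans (scalar_im_mk _ _ _))//; have := (bP x).2 n.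
  by rewrite /im indicE mem_set// mul1r.
have mg : is_Linfty_fun g.
  split.
  - under eq_fun do rewrite scalar_re_mk.
    apply: (@measurable_fun_cvg _ _ _ _ re) => [n|x _]; last exact: (aP x).1.
    by apply: measurable_funM; [exact: measurable_indic|case: (mf n)].
  - apply: scalar_im_mk_meas.
    apply: (@measurable_fun_cvg _ _ _ _ im) => [n|x _]; last exact: (bP x).1.
    by apply: measurable_funM; [exact: measurable_indic|case: (mf n)].
  - have [_ _ /Linfty_norm_finP[c c0 fc]] := mf 0%N.
    apply/Linfty_norm_finP; exists (c + (h 0%N + h 0%N)).
      by rewrite !addr_ge0// ltW.
    apply: filterS2 fc (fg 0%N) => x fc fgx.
    have -> : g x = f 0%N x + (g x - f 0%N x) by rewrite addrC subrK.
    rewrite (le_trans (modulusD _ _))// lerD//.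
    by move: fgx; rewrite /modulus distrC.
have gin : g \in Linfty_pred by apply/asboolP.
pose G : Linfty_fun := exist _ g gin.
apply/cvg_ex; exists (\pi_Linfty G).
apply/(@cvg_ballP K) => e e0.
have : exists n, scalar_of k (h n) *+ 3 < e.
  have eE : e = scalar_of k (modulus e) by rewrite -modulusE gtr0_norm.
  have re0 : 0 < modulus e / 3.
    by rewrite divr_gt0// -(scalar_of_lt k) scalar_of0 -eE.
  near \oo => n; exists n.
  have -> : scalar_of k (h n) *+ 3 = scalar_of k (h n * 3).
    by rewrite !mulrS mulr0n !mulrDr mulr1 mulr0 !scalar_ofD scalar_of0.
  rewrite eE scalar_of_lt -ltr_pdivlMr//.
  by near: n; exact: (near_infty_natSinv_lt (PosNum re0)).
move=> [n hn]; apply: filterS (uP n) => v uv.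
rewrite -ball_normE/=.
have uG : `|\pi_Linfty G - u n| <= scalar_of k (h n + h n).
  rewrite distrC -[X in X - _]reprK.
  have -> : \pi_Linfty (repr (u n)) - \pi_Linfty G = \pi_Linfty (repr (u n) - G).
    by rewrite -pi_oppr -pi_addr.
  rewrite -[`|_|]/(Linfty_normK _) Linfty_normK_pi scalar_of_le.
  by apply/Linfty_fineP; [rewrite addr_ge0// ltW|exact: fg].
rewrite -(subrK (u n) (\pi_Linfty G)) -addrA (le_lt_trans (ler_normD _ _))//.
rewrite (lt_trans _ hn)// !mulrS mulr0n addr0 addrA ler_ltD//.
by rewrite -scalar_ofD.
Unshelve. all: by end_near. Qed.

HB.instance Definition _ := Uniform_isComplete.Build Linfty Linfty_complete.

End Linfty.

Section numerical_radius.
Context (K : numFieldType) (X : completeNormedModType K).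

(* The suprema below are taken in [K], where norms are valued. In a complex
   field, [z <= w] means that [w - z] is a nonnegative real, so that on sets of
   nonnegative reals [supremum 0] is the usual supremum, as it is for the reals,
   with value 0 on empty or unbounded sets. Likewise [0 < e < 1] forces [e] to
   be real. *)
Definition op_norm (Y : normedModType K) (f : X -> Y) : K :=
  supremum 0 [set `|f x| | x in [set x : X | `|x| <= 1]].

Definition compact_operator (T : {linear X -> X}) : Prop :=
  precompact (T @` [set x : X | `|x| <= 1]).

(* The set Pi(X); continuity makes the second component an element of X^*. *)
Definition norming_pairs : set (X * {linear X -> K^o}) :=
  [set p : X * {linear X -> K^o} |
    [/\ `|p.1| = 1, continuous p.2, op_norm p.2 = 1 & p.2 p.1 = 1]].

Definition numerical_radius (T : X -> X) : K :=
  supremum 0 [set `|p.2 (T p.1)| | p in norming_pairs].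

Definition BPBp_nu_compact : Prop :=
  forall e : K, 0 < e < 1 -> exists2 eta : K, 0 < eta < 1 &
  forall (T : {linear X -> X}) (x : X) (x' : {linear X -> K^o}),
    compact_operator T -> norming_pairs (x, x') ->
    numerical_radius T = 1 -> 1 - eta < `|x' (T x)| ->
  exists (S : {linear X -> X}) (y : X) (y' : {linear X -> K^o}),
    [/\ compact_operator S, norming_pairs (y, y'),
        numerical_radius S = 1 /\ `|y' (S y)| = 1,
        op_norm (T \- S) < e
      & `|x - y| < e /\ op_norm (x' \- y') < e].

End numerical_radius.

(* Main.v *)
Require Import Defs.
Set Warnings "-all".
From HB Require Import structures.
From mathcomp Require Import all_boot all_order all_algebra generic_quotient complex.
From mathcomp Require Import ring lra.
From mathcomp Require Import all_classical all_reals all_analysis measurable_realfun.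
Set Implicit Arguments.
Unset Strict Implicit.
Unset Printing Implicit Defensive.
Import Order.TTheory GRing.Theory Num.Theory.
Import numFieldNormedType.Exports.
Local Open Scope classical_set_scope.
Local Open Scope ring_scope.

(** The numerical index of [L_inf] is 1: a function [u] in the unit ball is, near
    a point seen by an ultrafilter character [phi], a convex combination of two
    unimodular constants, so that [phi] certifies the norm of [T u] on a norming
    pair. Hence a compact [T] with numerical radius 1 is a contraction.

    Multiplying by the phase of [x] and by that of [x* (T x)], we may assume that
    [x >= 0]; then [x*] is a state, concentrated on every set [{x >= 1 - beta}],
    and [x* (T x) >= 1 - eta]. By uniform convexity of the scalars, [x*] almost
    lives on [D = {|T x - 1| < tau}]. As [T] is compact, [D] splits into finitely
    many pieces on which all [T u], [|u| <= 1], are almost constant; on a piece [P]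
    of positive [x*]-mass, [T u] is close to the average of [T u] with respect to
    [x*] conditioned on [P]. As a function of [u], this average is a functional of
    norm at most 1 almost equal to 1 at [x], so it is close to a state taking
    the value 1 at a modification [y] of [x] which is 1 where [x >= 1 - beta].
    Replacing [T u] on each such piece by the value of that state gives [S], and
    conditioning [x*] on the union of these pieces gives [y*].

    The nearby state is a normalized total variation: if [z_n] in the unit ball
    nearly maximize [f], the functionals [f (z_n .)] form a Cauchy sequence in
    norm, and [f] itself belongs to it approximately when [f 1] is almost [|f|]. *)

(** Composites, differences and limits arise as plain functions; bundling them makes the lemmas on
    [{linear X -> K^o}] applicable. *)
Lemma to_linear (K : numFieldType) (V W : lmodType K) (f : V -> W) :
  linear f -> exists g : {linear V -> W}, g =1 f.
Proof.
move=> lf; pose M := GRing.isLinear.Build K V W *:%R f lf.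
by pose g : {linear V -> W} := HB.pack f M; exists g.
Qed.

Lemma le_natSinv (R : realType) (x C : R) :
  (forall n, x <= C * n.+1%:R^-1) -> x <= 0.
Proof.
move=> xC; rewrite leNgt; apply/negP => x0.
(* The case [n = 0] already forces [C] to be positive. *)
have C0 : 0 < C by have := xC 0%N; rewrite invr1 mulr1; exact: lt_le_trans.
have xC0 : 0 < x / C by rewrite divr_gt0.
near \oo => n.
have : n.+1%:R^-1 < x / C by near: n; exact: (near_infty_natSinv_lt (PosNum xC0)).
by rewrite ltr_pdivlMr// mulrC ltNge xC.
Unshelve. all: by end_near. Qed.

(** * Scalars *)

Section scalars.
Context (R : realType) (k : scalar_kind).
Local Notation K := (scalar_field R k).
Implicit Types z w : K.

Lemma scalar_of1 : scalar_of k (1 : R) = 1. Proof. by case: k. Qed.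

Lemma scalar_ofN (x : R) : scalar_of k (- x) = - scalar_of k x.
Proof. by case: k => //=; rewrite rmorphN. Qed.

Lemma scalar_ofB (x y : R) : scalar_of k (x - y) = scalar_of k x - scalar_of k y.
Proof. by rewrite scalar_ofD scalar_ofN. Qed.

Lemma scalar_ofV (x : R) : scalar_of k x^-1 = (scalar_of k x)^-1.
Proof. by case: k => //=; rewrite fmorphV. Qed.

Lemma scalar_re_of (x : R) : scalar_re (scalar_of k x) = x.
Proof. by case: k. Qed.

Lemma scalar_im_of (x : R) : scalar_im (scalar_of k x) = 0.
Proof. by case: k. Qed.

Lemma scalar_reN z : scalar_re (- z) = - scalar_re z.
Proof. by case: k z => //= -[]. Qed.

Lemma scalar_eqP z w :
  scalar_re z = scalar_re w -> scalar_im z = scalar_im w -> z = w.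
Proof. by case: k z w => //= -[a b] [a' b']/= -> ->. Qed.

Lemma scalar_re_le_modulus z : scalar_re z <= modulus z.
Proof. exact: (le_trans (ler_norm _) (scalar_re_le _)). Qed.

Lemma modulus1 : modulus (1 : K) = 1.
Proof. by rewrite /modulus normr1 -scalar_of1 scalar_re_of. Qed.

Lemma modulus_of (x : R) : modulus (scalar_of k x) = `|x|.
Proof.
rewrite /modulus; case: k => //=.
by rewrite expr0n addr0 sqrtr_sqr.
Qed.

Lemma modulusN z : modulus (- z) = modulus z.
Proof. by rewrite /modulus normrN. Qed.

Lemma modulusBC z w : modulus (z - w) = modulus (w - z).
Proof. by rewrite -modulusN opprB. Qed.

Lemma modulusB z w : modulus (z - w) <= modulus z + modulus w.
Proof. by rewrite -(modulusN w) modulusD. Qed.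

Lemma modulusV z : modulus z^-1 = (modulus z)^-1.
Proof.
by apply: (@scalar_of_inj R k); rewrite scalar_ofV -!modulusE normfV.
Qed.

Lemma modulus_sqr z : modulus z ^+ 2 = scalar_re z ^+ 2 + scalar_im z ^+ 2.
Proof.
rewrite /modulus; case: k z => [z|[a b]] /=.
  by rewrite real_normK ?num_real// expr0n addr0.
by rewrite sqr_sqrtr// addr_ge0// sqr_ge0.
Qed.

(** Source of the uniform convexity of the scalars, real and complex alike. *)
Lemma parallelogram z w : modulus (z + w) ^+ 2 + modulus (z - w) ^+ 2 =
  2 * (modulus z ^+ 2 + modulus w ^+ 2).
Proof. by rewrite !modulus_sqr scalar_reD scalar_imD scalar_reB scalar_imB; ring. Qed.

Lemma scalar_phase z :
  exists2 s : K, modulus s = 1 & s * z = scalar_of k (modulus z).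
Proof.
have [->|z0] := eqVneq z 0.
  by exists 1; [exact: modulus1|rewrite modulus0 scalar_of0 mulr0].
exists (scalar_of k (modulus z) / z); last by rewrite divfK.
rewrite modulusM modulusV modulus_of ger0_norm ?modulus_ge0// divff//.
by apply: contra_neq z0; exact: modulus_eq0.
Qed.

Lemma modulus1_neq0 z : modulus z = 1 -> z != 0.
Proof. by move=> z1; apply: contra_eq_neq z1 => ->; rewrite modulus0 eq_sym oner_neq0. Qed.

End scalars.

(** * Pointwise operations on [L_inf] *)

Section Linfty_algebra.
Context (R : realType) (k : scalar_kind).
Context d (T : measurableType d) (mu : {measure set T -> \bar R}).
Local Notation K := (scalar_field R k).
Local Notation X := (Linfty k mu).
Local Open Scope quotient_scope.
Implicit Types (u v w : X) (E : set T) (a b c : R).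

(** The norm of [X] has its values in [K]; the estimates are carried out on this real-valued copy,
    which [lra] and [nra] can handle. *)
Definition nrm u : R := fine (Linfty_norm mu (val (repr u))).

(** A chosen representative of the class, whence the almost everywhere form of the rules below. *)
Definition ev u : T -> K := val (repr u).

Lemma nrmE u : `|u| = scalar_of k (nrm u). Proof. by []. Qed.

Lemma nrm_ge0 u : 0 <= nrm u. Proof. exact: fine_Linfty_ge0. Qed.

Lemma nrm_le_ball u a : (`|u| <= scalar_of k a) = (nrm u <= a).
Proof. by rewrite nrmE scalar_of_le. Qed.

Lemma nrm_leP u c : 0 <= c ->
  nrm u <= c <-> \forall t \ae mu, modulus (ev u t) <= c.
Proof. exact: Linfty_fineP. Qed.

Lemma ev_le u : \forall t \ae mu, modulus (ev u t) <= nrm u.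
Proof. exact: Linfty_fine_ae. Qed.

Lemma ev_inj u v : (\forall t \ae mu, ev u t = ev v t) -> u = v.
Proof.
by move=> uv; rewrite -[u]reprK -[v]reprK; apply/Linfty_eqP; apply: filterS uv.
Qed.

Lemma evD u v : \forall t \ae mu, ev (u + v) t = ev u t + ev v t.
Proof.
have : val (repr (\pi_X (repr u + repr v))) = val (repr u + repr v) %[ae mu].
  exact: Linfty_reprP.
by rewrite Linfty_piD !reprK; apply: filterS => t /(_ I).
Qed.

Lemma evZ (s : K) u : \forall t \ae mu, ev (s *: u) t = s * ev u t.
Proof.
have : val (repr (\pi_X (s *: repr u))) = val (s *: repr u) %[ae mu].
  exact: Linfty_reprP.
by rewrite -Linfty_scale_pi reprK; apply: filterS => t /(_ I).
Qed.

Lemma evN u : \forall t \ae mu, ev (- u) t = - ev u t.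
Proof. by rewrite -scaleN1r; apply: filterS (evZ (-1) u) => t ->; rewrite mulN1r. Qed.

Lemma evB u v : \forall t \ae mu, ev (u - v) t = ev u t - ev v t.
Proof. by apply: filterS2 (evD u (- v)) (evN v) => t -> ->. Qed.

Lemma ev0 : \forall t \ae mu, ev 0 t = 0.
Proof. by rewrite -(scale0r 0); apply: filterS (evZ 0 0) => t ->; rewrite mul0r. Qed.

Lemma ev_Linfty u : is_Linfty_fun mu (ev u).
Proof. by apply/asboolP; exact: (valP (repr u)). Qed.

Lemma measurable_ev_re u : measurable_fun setT (fun t => scalar_re (ev u t)).
Proof. by case: (ev_Linfty u). Qed.

Lemma measurable_ev_im u : measurable_fun setT (fun t => scalar_im (ev u t)).
Proof. by case: (ev_Linfty u). Qed.

Lemma measurable_modulus (f : T -> K) :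
  measurable_fun setT (fun t => scalar_re (f t)) ->
  measurable_fun setT (fun t => scalar_im (f t)) ->
  measurable_fun setT (fun t => modulus (f t)).
Proof.
move=> mr mi.
under eq_fun do rewrite -(ger0_norm (modulus_ge0 _)) -sqrtr_sqr modulus_sqr.
apply: (@measurableT_comp _ _ _ _ _ _ (@Num.sqrt R)).
  by apply: continuous_measurable_fun; exact: sqrt_continuous.
by apply: measurable_funD; exact: measurable_funX.
Qed.

(* Junk value: [Lmk f] is [0] unless [f] is measurable and essentially bounded. *)
Definition Lmk (f : T -> K) : X :=
  if insub f is Some g then \pi_X (g : Linfty_fun k mu) else 0.

Lemma ev_Lmk (f : T -> K) : is_Linfty_fun mu f ->
  \forall t \ae mu, ev (Lmk f) t = f t.
Proof.
move=> /asboolP fL; rewrite /Lmk /ev; case: insubP => [g _ gf|/negP//].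
have : val (repr (\pi_X g)) = val g %[ae mu] by exact: Linfty_reprP.
by rewrite gf; apply: filterS => t /(_ I).
Qed.

Definition Lmul u v : X := Lmk (fun t => ev u t * ev v t).

Lemma evM u v : \forall t \ae mu, ev (Lmul u v) t = ev u t * ev v t.
Proof.
have [ur ui _] := ev_Linfty u; have [vr vi _] := ev_Linfty v.
apply: ev_Lmk; split.
- under eq_fun do rewrite scalar_reM.
  by apply: measurable_funB; exact: measurable_funM.
- under eq_fun do rewrite scalar_imM.
  by apply: measurable_funD; exact: measurable_funM.
- apply/Linfty_norm_finP; exists (nrm u * nrm v).
    by rewrite mulr_ge0 ?nrm_ge0.
  apply: filterS2 (ev_le u) (ev_le v) => t ut vt.
  by rewrite modulusM ler_pM ?modulus_ge0.
Qed.

Definition Lind E : X := Lmk (fun t => (t \in E)%:R).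

Lemma ev_ind E : measurable E -> \forall t \ae mu, ev (Lind E) t = (t \in E)%:R.
Proof.
move=> mE; apply: ev_Lmk; split.
- rewrite [X in measurable_fun _ X](_ : _ = \1_E); first exact: measurable_indic.
  apply/funext => t; rewrite indicE; case: (t \in E) => /=.
    by rewrite -(scalar_of1 R k) scalar_re_of.
  exact: scalar_re0.
- rewrite [X in measurable_fun _ X](_ : _ = cst 0); first exact: measurable_cst.
  apply/funext => t; case: (t \in E) => /=.
    by rewrite -(scalar_of1 R k) scalar_im_of.
  exact: scalar_im0.
- apply/Linfty_norm_finP; exists 1 => //; apply: aeW => t /=.
  by case: (t \in E); rewrite ?modulus1 ?modulus0.
Qed.

Definition Lone : X := Lind setT.

Lemma ev1 : \forall t \ae mu, ev Lone t = 1.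
Proof. by apply: filterS (ev_ind measurableT) => t ->; rewrite in_setT. Qed.

Definition Lres E u : X := Lmul (Lind E) u.

Lemma ev_res E u : measurable E ->
  \forall t \ae mu, ev (Lres E u) t = if t \in E then ev u t else 0.
Proof.
move=> mE; apply: filterS2 (ev_ind mE) (evM (Lind E) u) => t -> ->.
by case: ifP; rewrite ?mul1r ?mul0r.
Qed.

Lemma LmulC u v : Lmul u v = Lmul v u.
Proof. by rewrite /Lmul; congr Lmk; apply/funext => t; rewrite mulrC. Qed.

Lemma LmulA u v w : Lmul u (Lmul v w) = Lmul (Lmul u v) w.
Proof.
apply: ev_inj; near=> t.
rewrite (near (evM u (Lmul v w))) // (near (evM v w)) // (near (evM (Lmul u v) w)) //.
by rewrite (near (evM u v)) // mulrA.
Unshelve. all: by end_near. Qed.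

End Linfty_algebra.

Section Linfty_norm_theory.
Context (R : realType) (k : scalar_kind).
Context d (T : measurableType d) (mu : {measure set T -> \bar R}).
Local Notation K := (scalar_field R k).
Local Notation X := (Linfty k mu).
Implicit Types (u v w : X) (E : set T) (a b c : R).

Lemma nrm0 : nrm (0 : X) = 0.
Proof. by apply: (@scalar_of_inj R k); rewrite -nrmE normr0 scalar_of0. Qed.

Lemma nrmD u v : nrm (u + v) <= nrm u + nrm v.
Proof. by rewrite -(scalar_of_le k) scalar_ofD -!nrmE ler_normD. Qed.

Lemma nrmZ (s : K) u : nrm (s *: u) = modulus s * nrm u.
Proof. by apply: (@scalar_of_inj R k); rewrite scalar_ofM -!nrmE -modulusE normrZ. Qed.

Lemma nrmN u : nrm (- u) = nrm u.
Proof. by apply: (@scalar_of_inj R k); rewrite -!nrmE normrN. Qed.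

Lemma nrmB u v : nrm (u - v) <= nrm u + nrm v.
Proof. by rewrite -(nrmN v) nrmD. Qed.

Lemma nrm_eq0 u : nrm u = 0 -> u = 0.
Proof. by move=> u0; apply/eqP; rewrite -normr_eq0 nrmE u0 scalar_of0. Qed.

Lemma nrmM u v : nrm (Lmul u v) <= nrm u * nrm v.
Proof.
apply/nrm_leP; first by rewrite mulr_ge0 ?nrm_ge0.
near=> t; rewrite (near (evM u v)) // modulusM ler_pM ?modulus_ge0//.
  by near: t; exact: ev_le.
by near: t; exact: ev_le.
Unshelve. all: by end_near. Qed.

Lemma nrmM1 u v : nrm u <= 1 -> nrm (Lmul u v) <= nrm v.
Proof.
by move=> u1; rewrite (le_trans (nrmM _ _))// ler_piMl// nrm_ge0.
Qed.

Lemma nrm_ind E : measurable E -> nrm (Lind k mu E) <= 1.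
Proof.
move=> mE; apply/nrm_leP => //; apply: filterS (ev_ind k mu mE) => t ->.
by case: (t \in E); rewrite ?modulus1 ?modulus0.
Qed.

Lemma nrm_res E u : measurable E -> nrm (Lres E u) <= nrm u.
Proof. by move=> mE; apply: nrmM1; exact: nrm_ind. Qed.

Lemma nrm1 : nrm (Lone k mu) <= 1. Proof. exact: nrm_ind. Qed.

Lemma Lmul_linear u : linear (Lmul u).
Proof.
move=> s v w; apply: ev_inj; near=> t.
rewrite (near (evM u (s *: v + w))) // (near (evD (s *: v) w)) //.
rewrite (near (evZ s v)) // (near (evD (s *: Lmul u v) (Lmul u w))) //.
rewrite (near (evZ s (Lmul u v))) // (near (evM u v)) // (near (evM u w)) //.
by rewrite mulrDr mulrCA.
Unshelve. all: by end_near. Qed.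

HB.instance Definition _ u :=
  GRing.isLinear.Build K X X *:%R (Lmul u) (Lmul_linear u).

Lemma Lres_linear E : linear (@Lres R k d T mu E).
Proof. exact: Lmul_linear. Qed.

HB.instance Definition _ E :=
  GRing.isLinear.Build K X X *:%R (Lres E) (Lres_linear E).

Lemma LresD E u v : Lres E (u + v) = Lres E u + Lres E v.
Proof. exact: linearD. Qed.

Lemma LresZ E (s : K) u : Lres E (s *: u) = s *: Lres E u.
Proof. exact: linearZ. Qed.

Lemma LresB E u v : Lres E (u - v) = Lres E u - Lres E v.
Proof. exact: linearB. Qed.

Lemma LmulZr (s : K) u v : Lmul u (s *: v) = s *: Lmul u v.
Proof. exact: linearZ. Qed.

Lemma LmulBr u v w : Lmul u (v - w) = Lmul u v - Lmul u w.
Proof. exact: linearB. Qed.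

Lemma LmulBl u v w : Lmul (u - v) w = Lmul u w - Lmul v w.
Proof. by rewrite !(LmulC _ w) linearB. Qed.

Lemma Lmul1 u : Lmul (Lone k mu) u = u.
Proof.
apply: ev_inj; near=> t.
by rewrite (near (evM (Lone k mu) u)) // (near (ev1 k mu)) // mul1r.
Unshelve. all: by end_near. Qed.

Lemma LresI E F u : measurable E -> measurable F ->
  Lres E (Lres F u) = Lres (E `&` F) u.
Proof.
move=> mE mF; apply: ev_inj; near=> t.
rewrite (near (ev_res (Lres F u) mE)) // (near (ev_res u mF)) //.
rewrite (near (ev_res u (measurableI _ _ mE mF))) // in_setI.
by case: (t \in E).
Unshelve. all: by end_near. Qed.

Lemma Lres_mul E u v : Lres E (Lmul u v) = Lmul u (Lres E v).
Proof. by rewrite /Lres !LmulA (LmulC _ u). Qed.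

Lemma Lres_setC E u : measurable E -> Lres E u + Lres (~` E) u = u.
Proof.
move=> mE; apply: ev_inj; near=> t.
rewrite (near (evD (Lres E u) (Lres (~` E) u))) // (near (ev_res u mE)) //.
rewrite (near (ev_res u (measurableC mE))) // in_setC.
by case: (t \in E); rewrite ?addr0 ?add0r.
Unshelve. all: by end_near. Qed.

Lemma nrm_split E u v c : measurable E -> nrm u <= c -> nrm v <= c ->
  nrm (Lres E u + Lres (~` E) v) <= c.
Proof.
move=> mE uc vc; apply/nrm_leP; first exact: le_trans (nrm_ge0 u) uc.
near=> t.
rewrite (near (evD (Lres E u) (Lres (~` E) v))) // (near (ev_res u mE)) //.
rewrite (near (ev_res v (measurableC mE))) // in_setC.
case: (t \in E); rewrite ?addr0 ?add0r /=.
  by apply: le_trans uc; near: t; exact: ev_le.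
by apply: le_trans vc; near: t; exact: ev_le.
Unshelve. all: by end_near. Qed.

Lemma measurable_modulus_ge u v a :
  measurable [set t | a <= modulus (ev u t - ev v t)].
Proof.
have -> : [set t | a <= modulus (ev u t - ev v t)] =
    (fun t => modulus (ev u t - ev v t)) @^-1` `[a, +oo[.
  by apply/seteqP; split => t /=; rewrite in_itv/= andbT.
rewrite -[X in measurable X]setTI; apply: measurable_modulus => //.
  under eq_fun do rewrite scalar_reB.
  by apply: measurable_funB; exact: measurable_ev_re.
under eq_fun do rewrite scalar_imB.
by apply: measurable_funB; exact: measurable_ev_im.
Qed.

End Linfty_norm_theory.

(** * Functionals that almost attain their norm *)

Section functionals.
Context (R : realType) (k : scalar_kind).
Context d (T : measurableType d) (mu : {measure set T -> \bar R}).
Local Notation K := (scalar_field R k).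
Local Notation X := (Linfty k mu).
Implicit Types (f : {linear X -> K^o}) (u v h : X) (E : set T) (c : R).

Definition bounded_by f c := forall u, modulus (f u : K) <= c * nrm u.

Lemma bounded_by_ball f c u : 0 <= c -> bounded_by f c -> nrm u <= 1 ->
  modulus (f u : K) <= c.
Proof.
by move=> c0 fc u1; rewrite (le_trans (fc u))// ler_piMr.
Qed.

Lemma functional_phase f u : exists2 s : K, modulus s = 1 &
  f (s *: u) = scalar_of k (modulus (f u : K)).
Proof. by have [s s1 su] := scalar_phase (f u : K); exists s; rewrite ?linearZ. Qed.

(* If [f] almost peaks at [a], then it is small where [|a|] is bounded away from
   [1]: perturb [a] there. *)
Lemma small_off_peak f c (a h : X) (kap del : R) E :
  measurable E -> 0 <= c -> bounded_by f c -> 0 <= kap ->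
  (\forall t \ae mu, modulus (ev a t) <= if t \in E then 1 - kap else 1) ->
  c - del <= scalar_re (f a : K) -> nrm h <= 1 ->
  kap * modulus (f (Lres E h) : K) <= del.
Proof.
move=> mE c0 fc kap0 aE fa h1.
have [s s1 fs] := functional_phase f (Lres E h).
(* On [E] the room [kap] left by [a] is filled with [h]; the phase [s] makes the added value of [f]
   a nonnegative real, so that nothing cancels. *)
pose b := a + scalar_of k kap *: (s *: Lres E h).
have b1 : nrm b <= 1.
  apply/nrm_leP => //; near=> t.
  rewrite (near (evD a (scalar_of k kap *: (s *: Lres E h)))) //.
  rewrite (near (evZ (scalar_of k kap) (s *: Lres E h))) //.
  rewrite (near (evZ s (Lres E h))) // (near (ev_res h mE)) //.
  have at1 : modulus (ev a t) <= if t \in E then 1 - kap else 1 by near: t.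
  have ht : modulus (ev h t) <= 1.
    by apply: le_trans h1; near: t; exact: ev_le.
  apply: (le_trans (modulusD _ _)); rewrite !modulusM s1 mul1r modulus_of ger0_norm//.
  move: at1; case: (t \in E) => at1; last by rewrite modulus0 mulr0 addr0.
  have := ler_wpM2l kap0 ht; rewrite mulr1; lra.
have := bounded_by_ball c0 fc b1.
rewrite linearD linearZ fs => fb.
have := le_trans (scalar_re_le_modulus _) fb.
rewrite scalar_reD -[X in scalar_re X + scalar_re _]/(f a : K).
have -> : scalar_re (scalar_of k kap *: (scalar_of k (modulus (f (Lres E h) : K)) : K^o) : K)
    = kap * modulus (f (Lres E h) : K).
  by rewrite -[X in scalar_re X]/(_ * _) -scalar_ofM scalar_re_of.
by move: fa; set p := scalar_re _; set q := kap * _; lra.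
Unshelve. all: by end_near. Qed.

(** The parallelogram law bounds [|z + w|^2] by [4 - tau^2], and [1 - tau^2 / 8] is an upper bound
    of [sqrt (1 - tau^2 / 4)]. *)
Lemma modulus_midpoint (z w : K) (tau : R) : 0 <= tau ->
  modulus z <= 1 -> modulus w <= 1 -> tau <= modulus (z - w) ->
  modulus (z + w) / 2 <= 1 - tau ^+ 2 / 8.
Proof.
move=> tau0 z1 w1 zw.
have zz : modulus z ^+ 2 <= 1 by rewrite expr_le1// modulus_ge0.
have ww : modulus w ^+ 2 <= 1 by rewrite expr_le1// modulus_ge0.
have tt : tau ^+ 2 <= modulus (z - w) ^+ 2 by rewrite lerXn2r ?nnegrE ?modulus_ge0.
have := parallelogram z w; have := modulus_ge0 (z + w).
move: (modulus (z + w)) => p p0 pw; rewrite leNgt; apply/negP => pt.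
have t2 : 0 <= tau ^+ 2 by exact: sqr_ge0.
nra.
Qed.

Section two_peaks.
Variables (f : {linear X -> K^o}) (c : R) (a b : X) (del tau : R).
Hypotheses (c0 : 0 <= c) (fc : bounded_by f c) (tau0 : 0 < tau).
Hypotheses (a1 : nrm a <= 1) (b1 : nrm b <= 1).
Hypotheses (fa : c - del <= scalar_re (f a : K)) (fb : c - del <= scalar_re (f b : K)).

(** The midpoint of two near peaks is a near peak, and by [modulus_midpoint] it drops to
    [1 - tau ^+ 2 / 8] where [a] and [b] are [tau] apart; [small_off_peak] applies to it. *)
Lemma small_off_two_peaks h : nrm h <= 1 ->
  modulus (f (Lres [set t | tau <= modulus (ev a t - ev b t)] h) : K)
    <= 8 * del / tau ^+ 2.
Proof.
have eighth (x y z : R) : x / 8 * y <= z -> y * x <= 8 * z by lra.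
move=> h1; pose m := scalar_of k 2^-1 *: (a + b).
have := @small_off_peak f c m h (tau ^+ 2 / 8) del _ (measurable_modulus_ge a b tau) c0 fc.
move: (modulus _) => q H; rewrite ler_pdivlMr ?exprn_gt0//.
suff : tau ^+ 2 / 8 * q <= del by exact: eighth.
apply: H => //.
- by rewrite divr_ge0// sqr_ge0.
- near=> t; rewrite (near (evZ (scalar_of k 2^-1) (a + b))) // (near (evD a b)) //.
  rewrite modulusM modulus_of ger0_norm ?invr_ge0// mulrC.
  have at1 : modulus (ev a t) <= 1 by apply: le_trans a1; near: t; exact: ev_le.
  have bt1 : modulus (ev b t) <= 1 by apply: le_trans b1; near: t; exact: ev_le.
  case: ifPn => [|_]; first by rewrite inE /=; apply: modulus_midpoint => //; exact: ltW.
  by have := modulusD (ev a t) (ev b t); lra.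
- have -> : f m = scalar_of k 2^-1 * ((f a : K) + f b) :> K.
    by rewrite /m linearZ linearD.
  rewrite scalar_reM scalar_re_of scalar_im_of mul0r subr0 scalar_reD.
  by move: fa fb; set p := scalar_re _; set q' := scalar_re _; lra.
Unshelve. all: by end_near. Qed.

(** Where [a] and [b] are [tau] apart, the previous estimate is applied to half of [(a - b) h],
    which lies in the unit ball; elsewhere the product has modulus at most [tau]. With [del] of
    order [tau ^+ 3] both terms are of order [tau]. *)
Lemma two_peaks_close h : nrm h <= 1 ->
  modulus (f (Lmul (a - b) h) : K) <= 16 * del / tau ^+ 2 + c * tau.
Proof.
move=> h1; set E := [set t | tau <= modulus (ev a t - ev b t)].
have mE : measurable E by exact: measurable_modulus_ge.
rewrite -(Lres_setC (Lmul _ _) mE) linearD (le_trans (modulusD _ _))// lerD//.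
  pose h' := scalar_of k 2^-1 *: Lmul (a - b) h.
  have h'1 : nrm h' <= 1.
    rewrite nrmZ modulus_of ger0_norm ?invr_ge0//.
    have := nrmM (a - b) h; have := nrmB a b; move: a1 b1 h1 (nrm_ge0 h) (nrm_ge0 (a - b)).
    by move: (nrm a) (nrm b) (nrm h) (nrm (a - b)) (nrm (Lmul _ _)) => *; nra.
  have -> : Lmul (a - b) h = scalar_of k 2 *: h'.
    by rewrite scalerA -scalar_ofM divff// scalar_of1 scale1r.
  rewrite linearZ linearZ -[X in modulus X]/(_ * _) modulusM modulus_of ger0_norm//.
  by have := small_off_two_peaks h'1; rewrite -/E; set q := modulus _; lra.
apply: (le_trans (fc _)); rewrite ler_wpM2l//; apply/nrm_leP; first exact: ltW.
near=> t; rewrite (near (ev_res (Lmul (a - b) h) (measurableC mE))) // in_setC.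
case: ifPn => [|_]; last by rewrite modulus0 ltW.
rewrite notin_setE /= => /negP; rewrite -ltNge => abt.
rewrite (near (evM (a - b) h)) // (near (evB a b)) // modulusM.
have ht : modulus (ev h t) <= 1 by apply: le_trans h1; near: t; exact: ev_le.
by rewrite (le_trans _ (ltW abt))// ler_piMr// modulus_ge0.
Unshelve. all: by end_near. Qed.

End two_peaks.

(* The dual of an [L_inf] space is an [l_1]-sum along a measurable partition. *)
Lemma bounded_by_split f c E u v : measurable E -> bounded_by f c -> 0 <= c ->
  nrm u <= 1 -> nrm v <= 1 ->
  modulus (f (Lres E u) : K) + modulus (f (Lres (~` E) v) : K) <= c.
Proof.
move=> mE fc c0 u1 v1.
have [s s1 fs] := functional_phase f (Lres E u).
have [r r1 fr] := functional_phase f (Lres (~` E) v).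
have su1 : nrm (s *: u) <= 1 by rewrite nrmZ s1 mul1r.
have rv1 : nrm (r *: v) <= 1 by rewrite nrmZ r1 mul1r.
have := bounded_by_ball c0 fc (nrm_split mE su1 rv1).
rewrite linearD !LresZ fs fr.
rewrite -[X in modulus X]/(_ + _ : K) -scalar_ofD modulus_of ger0_norm//.
by rewrite addr_ge0 ?modulus_ge0.
Qed.

End functionals.

(** * States as finitely additive probabilities, and conditioning *)

Section states.
Context (R : realType) (k : scalar_kind).
Context d (T : measurableType d) (mu : {measure set T -> \bar R}).
Local Notation K := (scalar_field R k).
Local Notation X := (Linfty k mu).
Local Notation one := (Lone k mu).
Implicit Types (f psi : {linear X -> K^o}) (u v h : X) (E : set T) (c : R).

Lemma bounded_byP f c :
  (forall u, nrm u <= 1 -> modulus (f u : K) <= c) -> bounded_by f c.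
Proof.
move=> fc u; have [u0|u0] := eqVneq (nrm u) 0.
  by rewrite (nrm_eq0 u0) linear0 nrm0 modulus0 mulr0.
have un : 0 < nrm u by rewrite lt_neqAle eq_sym u0 nrm_ge0.
have : modulus (f (scalar_of k (nrm u)^-1 *: u) : K) <= c.
  by apply: fc; rewrite nrmZ modulus_of ger0_norm ?invr_ge0 ?nrm_ge0// mulVf.
rewrite linearZ -[X in modulus X]/(_ * _ : K) modulusM modulus_of.
by rewrite ger0_norm ?invr_ge0 ?nrm_ge0// mulrC ler_pdivrMr.
Qed.

Definition state psi := bounded_by psi 1 /\ psi one = 1.

(** A state is a finitely additive probability, of which this is the value at [E]; the real part
    loses nothing, by [state_res1]. *)
Definition mass psi E : R := scalar_re (psi (Lres E one) : K).

Section mass.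
Variable psi : {linear X -> K^o}.
Hypothesis psiS : state psi.

(** The two values of [psi] add up to 1 while their moduli add up to at most 1, so each real part
    equals the modulus. *)
Let mass_aux E : measurable E ->
  [/\ mass psi E = modulus (psi (Lres E one) : K),
      mass psi (~` E) = modulus (psi (Lres (~` E) one) : K) &
      mass psi E + mass psi (~` E) = 1].
Proof.
move=> mE; have [psi1 psione] := psiS.
have s1 : mass psi E + mass psi (~` E) = 1.
  rewrite /mass -scalar_reD -[X in scalar_re X]/(psi _ + psi _) -linearD.
  by rewrite Lres_setC// psione -(scalar_of1 R k) scalar_re_of.
have := bounded_by_split mE psi1 ler01 (nrm1 k mu) (nrm1 k mu).
have := scalar_re_le_modulus (psi (Lres E one) : K).
have := scalar_re_le_modulus (psi (Lres (~` E) one) : K).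
move: s1; rewrite /mass.
move: (scalar_re _) (scalar_re _) (modulus _) (modulus _) => x y z t *.
by split=> //; lra.
Qed.

Lemma mass_modulus E : measurable E -> mass psi E = modulus (psi (Lres E one) : K).
Proof. by move=> /mass_aux[]. Qed.

Lemma mass_ge0 E : measurable E -> 0 <= mass psi E.
Proof. by move=> /mass_modulus ->; exact: modulus_ge0. Qed.

Lemma massC E : measurable E -> mass psi E + mass psi (~` E) = 1.
Proof. by move=> /mass_aux[]. Qed.

Lemma state_res1 E : measurable E -> psi (Lres E one) = scalar_of k (mass psi E).
Proof.
move=> mE; apply: scalar_eqP; first by rewrite scalar_re_of.
rewrite scalar_im_of; apply/eqP; rewrite -sqrf_eq0.
have := modulus_sqr (psi (Lres E one) : K); rewrite -mass_modulus//.
by rewrite -[LHS]addr0 => /addrI <-.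
Qed.

(** Placing [one] on the complement in [bounded_by_split] uses up the mass of the complement, and
    leaves at most [mass psi E] for [u]. *)
Lemma state_res_le E u : measurable E ->
  modulus (psi (Lres E u) : K) <= mass psi E * nrm u.
Proof.
move=> mE; have [psi1 _] := psiS.
have [g gE] := @to_linear K X K^o (psi \o Lres E) (@linearP _ _ _ _ (psi \o Lres E)).
rewrite -[psi _]/((psi \o Lres E) u) -gE; apply: bounded_byP => {}u u1.
rewrite gE /=; have := bounded_by_split mE psi1 ler01 u1 (nrm1 k mu).
have := massC mE; rewrite (mass_modulus (measurableC mE)).
by move: (modulus _) (modulus _) (mass _ _) => x y z; lra.
Qed.

(** Conditioning on [E]. The distance to [psi] has two contributions of size [1 - mass psi E]: the
    part lost off [E] and the rescaling on [E]. *)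
Lemma cond_state E : measurable E -> 0 < mass psi E ->
  exists phi, [/\ state phi,
    forall u, phi u = (scalar_of k (mass psi E)^-1 : K) * psi (Lres E u) &
    forall u, modulus (psi u - phi u : K) <= 2 * (1 - mass psi E) * nrm u].
Proof.
move=> mE p0; set p := mass psi E in p0 *.
pose h u : K^o := (scalar_of k p^-1 : K) * psi (Lres E u).
have lh : linear h.
  move=> s u v; rewrite /h LresD LresZ linearD linearZ.
  by rewrite mulrDr mulrCA.
have [phi phiE] := to_linear lh; exists phi.
have hle u : modulus (h u : K) <= nrm u.
  rewrite /h modulusM modulus_of ger0_norm ?invr_ge0 ?(ltW p0)//.
  by rewrite ler_pdivrMl// state_res_le.
split=> //.
- split=> [u|]; first by rewrite mul1r phiE.
  by rewrite phiE /h state_res1// -scalar_ofM mulVf ?gt_eqF// scalar_of1.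
- move=> u; rewrite phiE /h -{1}(Lres_setC u mE) linearD.
  have -> : (psi (Lres E u) + psi (Lres (~` E) u) - scalar_of k p^-1 * psi (Lres E u) : K)
    = psi (Lres (~` E) u) - scalar_of k (p^-1 - 1) * psi (Lres E u).
    by rewrite scalar_ofB scalar_of1; ring.
  apply: (le_trans (modulusB _ _)); rewrite modulusM modulus_of.
  have pm := massC mE; rewrite -/p in pm.
  have p1 : p <= 1 by have := mass_ge0 (measurableC mE); lra.
  rewrite ger0_norm ?subr_ge0 ?invf_ge1//.
  have := state_res_le u mE; rewrite -/p => H1.
  have := state_res_le u (measurableC mE).
  have -> : mass psi (~` E) = 1 - p by lra.
  have H2 : (p^-1 - 1) * modulus (psi (Lres E u) : K) <= (p^-1 - 1) * (p * nrm u).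
    by rewrite ler_wpM2l// subr_ge0 invf_ge1.
  have H3 : (p^-1 - 1) * (p * nrm u) = (1 - p) * nrm u.
    by rewrite mulrA mulrBl mulVf ?gt_eqF// mul1r.
  by move: H2; rewrite H3; move: (modulus _) (_ * modulus _) (nrm u) => *; lra.
Qed.

End mass.
End states.

(** * The normalized total variation of a functional *)

Section nearby_state.
Context (R : realType) (k : scalar_kind).
Context d (T : measurableType d) (mu : {measure set T -> \bar R}).
Local Notation K := (scalar_field R k).
Local Notation X := (Linfty k mu).
Local Notation one := (Lone k mu).
Implicit Types (f : {linear X -> K^o}) (u v h : X) (E : set T) (c : R).

Lemma scalar_cauchy_harmonic (a : nat -> K) (C : R) : 0 < C ->
  (forall n m, modulus (a n - a m) <= C * (n.+1%:R^-1 + m.+1%:R^-1)) ->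
  exists l : K, forall n, modulus (a n - l) <= 2 * C * n.+1%:R^-1.
Proof.
move=> C0 aC.
have aux (b : nat -> R) : (forall n m, `|b n - b m| <= modulus (a n - a m)) ->
    exists l, forall n, `|b n - l| <= C * n.+1%:R^-1.
  move=> ba; have [n m|l _ bl] := @cauchy_harmonic R (fun n => C^-1 * b n).
    rewrite -mulrBr normrM gtr0_norm ?invr_gt0// ler_pdivrMl//.
    exact: le_trans (ba _ _) (aC _ _).
  exists (C * l) => n; rewrite -(ler_pdivrMl _ _ C0) -[C^-1 in X in X <= _]gtr0_norm ?invr_gt0//.
  by rewrite -normrM mulrBr mulKf ?gt_eqF.
have [x xa] : exists l, forall n, `|scalar_re (a n) - l| <= C * n.+1%:R^-1.
  by apply: aux => n m; rewrite -scalar_reB scalar_re_le.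
have [y ya] : exists l, forall n, `|scalar_im (a n) - l| <= C * n.+1%:R^-1.
  by apply: aux => n m; rewrite -scalar_imB scalar_im_le.
exists (scalar_mk k x y) => n; rewrite (le_trans (modulus_le _))//.
rewrite -mulrA mulr2n mulrDl mul1r lerD//.
  by rewrite scalar_reB scalar_re_mk.
by rewrite (le_trans (scalar_im_mk _ _ _)).
Qed.

(** The number [c] is the norm of [f]; near-maximizers are rotated so that [f] is real and
    nonnegative at them. *)
Lemma bounded_by_sup f : bounded_by f 1 -> exists c, [/\ 0 <= c <= 1, bounded_by f c &
  forall del, 0 < del -> exists z, [/\ nrm z <= 1,
    f z = scalar_of k (modulus (f z : K)) & c - del <= modulus (f z : K) <= c]].
Proof.
move=> f1; pose A := [set modulus (f u : K) | u in [set u | nrm u <= 1]].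
have A0 : A 0 by exists 0; rewrite /= ?nrm0// linear0 modulus0.
have uA : ubound A 1 by move=> _ [u u1 <-]; exact: bounded_by_ball.
have hA : has_sup A by split; [exists 0|exists 1].
have lA u : nrm u <= 1 -> modulus (f u : K) <= sup A.
  by move=> u1; apply: (sup_upper_bound hA); exists u.
exists (sup A); split.
- by rewrite (sup_upper_bound hA)// ge_sup//; exists 0.
- exact: bounded_byP.
- move=> del del0; have [_ [u u1 <-] fu] := sup_adherent del0 hA.
  have [s s1 su] := functional_phase f u; exists (s *: u).
  rewrite nrmZ s1 mul1r su modulus_of ger0_norm ?modulus_ge0//; split=> //.
  by rewrite (ltW fu) lA.
Qed.

(** The state is the total variation of [f] divided by its value [c] at [one]. The last clause
    preserves supports; it later makes the state vanish off the peak set. *)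
Lemma nearby_state f (sig : R) : bounded_by f 1 -> 0 < sig < 1 ->
  1 - sig ^+ 3 <= scalar_re (f one : K) ->
  exists g, [/\ state g,
    forall u, modulus (f u - g u : K) <= 18 * sig * nrm u &
    forall E, measurable E -> (forall u, f (Lres E u) = 0) ->
      forall u, g (Lres E u) = 0].
Proof.
move=> f1 /andP[sig0 sig1] fone.
have [c [/andP[c0 c1] fc csup]] := bounded_by_sup f1.
have cge : 1 - sig ^+ 3 <= c.
  apply: (le_trans fone); apply: (le_trans (scalar_re_le_modulus _)).
  by apply: bounded_by_ball => //; exact: nrm1.
have sig31 : sig ^+ 3 < 1 by rewrite exprn_ilt1// ltW.
have cgt0 : 0 < c by lra.
(* With [del n <= tau n ^+ 3 / 16], [two_peaks_close] yields at most [2 * tau n = n.+1%:R^-1]; the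
   minimum in [del] also makes [z n] as good a peak as [one]. *)
pose tau n : R := n.+1%:R^-1 / 2.
have tau0 n : 0 < tau n by rewrite divr_gt0// invr_gt0.
have tau_le n m : (n <= m)%N -> tau m <= tau n.
  by move=> nm; rewrite /tau ler_pM2r ?invr_gt0// lef_pV2 ?posrE// ler_nat ltnS.
pose del n : R := Num.min (tau n ^+ 3 / 16) (sig ^+ 3).
have del0 n : 0 < del n by rewrite /del lt_min divr_gt0 ?exprn_gt0.
have del_le n m : (n <= m)%N -> del m <= tau n ^+ 3 / 16.
  move=> nm; rewrite /del ge_min ler_pM2r ?invr_gt0//.
  by rewrite lerXn2r ?nnegrE ?(ltW (tau0 _)) ?tau_le.
have /choice[z zP] n := csup _ (del0 n).
have z1 n : nrm (z n) <= 1 by case: (zP n).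
have fz n : f (z n) = scalar_of k (modulus (f (z n) : K)) by case: (zP n).
have fzc n : c - del n <= scalar_re (f (z n) : K).
  by rewrite fz scalar_re_of; case: (zP n) => _ _ /andP[].
have close h n m : (n <= m)%N -> nrm h <= 1 ->
    modulus (f (Lmul (z n - z m) h) : K) <= n.+1%:R^-1.
  move=> nm h1; have zcn i : (n <= i)%N -> c - tau n ^+ 3 / 16 <= scalar_re (f (z i) : K).
    by move=> /del_le; have := fzc i; move: (scalar_re _) (del i) => x y; lra.
  have := two_peaks_close c0 fc (tau0 n) (z1 n) (z1 m) (zcn n (leqnn _)) (zcn m nm) h1.
  have -> : 16 * (tau n ^+ 3 / 16) / tau n ^+ 2 = tau n.
    by have := tau0 n; move: (tau n) => t t0; field; rewrite gt_eqF.
  move=> /le_trans; apply; rewrite [leRHS]splitr -/(tau n) lerD2l.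
  by rewrite ler_piMl// ltW.
(* The constant is [nrm h + 1] because the limit lemma asks for a positive one. *)
have cauchy h n m : modulus ((f (Lmul (z n) h) : K) - f (Lmul (z m) h)) <=
    (nrm h + 1) * (n.+1%:R^-1 + m.+1%:R^-1).
  pose F := f \o Lmul (z n - z m).
  have [G GE] := @to_linear K X K^o F (@linearP _ _ _ _ F).
  have -> : (f (Lmul (z n) h) : K) - f (Lmul (z m) h) = G h.
    by rewrite GE /F /= LmulBl linearB.
  suff : modulus (G h : K) <= (n.+1%:R^-1 + m.+1%:R^-1) * nrm h.
    move=> /le_trans; apply; rewrite [leLHS]mulrC.
    by apply: ler_wpM2r; rewrite ?addr_ge0 ?lerDl.
  apply: bounded_byP => {}h h1; rewrite GE /F /=.
  have [nm|mn] := leP n m; first by rewrite (le_trans (close _ _ _ nm h1))// lerDl.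
  have -> : Lmul (z n - z m) h = - Lmul (z m - z n) h by rewrite !LmulBl opprB.
  rewrite linearN -[X in modulus X]/(- _ : K) modulusN.
  by rewrite (le_trans (close _ _ _ (ltnW mn) h1))// lerDr.
have /choice[g0 g0P] h : exists l : K, forall n,
    modulus ((f (Lmul (z n) h) : K) - l) <= 2 * (nrm h + 1) * n.+1%:R^-1.
  by apply: scalar_cauchy_harmonic => [|n m]; [rewrite ltr_wpDl ?nrm_ge0|exact: cauchy].
have lin0 : linear (g0 : X -> K^o).
  move=> s u v; apply/eqP; rewrite -subr_eq0; apply/eqP.
  apply: (@modulus_eq0 R k); apply/le_anti; rewrite modulus_ge0 andbT.
  apply: (@le_natSinv _ _ (2 * (nrm (s *: u + v) + 1) +
     modulus s * (2 * (nrm u + 1)) + 2 * (nrm v + 1))) => n.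
  (* Since [f (Lmul (z n) _)] is linear, the defect of [g0] is a combination of three approximation
     errors of order [n.+1%:R^-1]. *)
  have -> : g0 (s *: u + v) - (s *: (g0 u : K^o) + g0 v) =
    - ((f (Lmul (z n) (s *: u + v)) : K) - g0 (s *: u + v)) +
    s * ((f (Lmul (z n) u) : K) - g0 u) + ((f (Lmul (z n) v) : K) - g0 v).
    have -> : f (Lmul (z n) (s *: u + v)) = s * f (Lmul (z n) u) + f (Lmul (z n) v) :> K.
      by rewrite !linearP.
    by rewrite -[s *: (_ : K^o)]/(s * g0 u); ring.
  rewrite (le_trans (modulusD _ _))// mulrDl lerD ?g0P//.
  rewrite (le_trans (modulusD _ _))// mulrDl lerD ?modulusN ?g0P//.
  by rewrite modulusM -[leRHS]mulrA ler_wpM2l ?modulus_ge0.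
have g0c h : modulus (g0 h) <= c * nrm h.
  rewrite -subr_le0; apply: (@le_natSinv _ _ (2 * (nrm h + 1))) => n.
  rewrite lerBlDr -(subrK (f (Lmul (z n) h) : K) (g0 h)) (le_trans (modulusD _ _))//.
  rewrite modulusBC lerD// (le_trans (fc _))// ler_wpM2l// nrmM1//.
(* At [one] the approximating functionals take the values [f (z n)], which tend to [c]. *)
have g01 : g0 one = scalar_of k c.
  apply/eqP; rewrite -subr_eq0; apply/eqP.
  apply: (@modulus_eq0 R k); apply/le_anti; rewrite modulus_ge0 andbT.
  apply: (@le_natSinv _ _ (2 * (nrm one + 1) + 1)) => n.
  rewrite -(subrK (f (Lmul (z n) one) : K) (g0 one)) -addrA (le_trans (modulusD _ _))//.
  rewrite modulusBC mulrDl lerD// LmulC Lmul1 fz -scalar_ofB modulus_of mul1r.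
  case: (zP n) => _ _ /andP[cz zc]; rewrite distrC ger0_norm ?subr_ge0//.
  apply: (@le_trans _ _ (tau n)); last by rewrite /tau ler_pdivrMr// ler_peMr// ler1n.
  rewrite lerBlDr addrC -lerBlDr (le_trans _ cz)// lerB// (le_trans (del_le _ _ (leqnn n)))//.
  have : n.+1%:R^-1 <= 1 :> R by rewrite invf_le1 ?ler1n.
  move=> n1; have {n1} : tau n <= 1 by move: n1; rewrite /tau; move: (_^-1) => x; lra.
  by have := tau0 n; move: (tau n) => t; nra.
(* Here [one] is compared with [z n]: [two_peaks_close] with [tau = sig] and [del = sig ^+ 3] gives
   [16 * sig + c * sig]. *)
have fg0 h : nrm h <= 1 -> modulus ((f h : K) - g0 h) <= 17 * sig.
  move=> h1; rewrite -subr_le0; apply: (@le_natSinv _ _ (2 * (nrm h + 1))) => n.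
  rewrite lerBlDr [leRHS]addrC -(subrK (f (Lmul (z n) h) : K) (f h : K)) -addrA.
  rewrite (le_trans (modulusD _ _))// lerD//.
  have fone' : c - sig ^+ 3 <= scalar_re (f one : K) by apply: le_trans fone; lra.
  have fzn : c - sig ^+ 3 <= scalar_re (f (z n) : K).
    by apply: le_trans (fzc n); rewrite lerB// /del ge_min lexx orbT.
  have := two_peaks_close c0 fc sig0 (nrm1 k mu) (z1 n) fone' fzn h1.
  rewrite LmulBl Lmul1 linearB => /le_trans; apply.
  have -> : 16 * sig ^+ 3 / sig ^+ 2 = 16 * sig by field; rewrite gt_eqF.
  by have := ler_wpM2r (ltW sig0) c1; lra.
(* Division by [c] makes the value at [one] equal to 1 and costs at most [1 - c <= sig ^+ 3 <= sig],
   whence the constant 18. *)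
have lin : linear (fun h => (scalar_of k c^-1 * g0 h : K^o)).
  by move=> s u v; rewrite lin0 mulrDr mulrCA.
have [g gE] := to_linear lin; exists g; split.
- split=> [u|]; last by rewrite gE g01 -scalar_ofM mulVf ?gt_eqF// scalar_of1.
  rewrite gE modulusM modulus_of ger0_norm ?invr_ge0// ler_pdivrMl// mul1r.
  exact: g0c.
- have fg : linear (fun u => f u - g u : K^o).
    by move=> s u v; rewrite !linearP /= addrACA -scalerDr.
  have [F FE] := to_linear fg.
  move=> u; rewrite -[X in modulus X]FE; apply: bounded_byP => {}u u1.
  rewrite FE -(subrK (g0 u) (f u : K)) -addrA (le_trans (modulusD _ _))//.
  have -> : 18 * sig = 17 * sig + sig by ring.
  rewrite lerD ?fg0// gE -{1}[g0 u]mul1r -mulrBl -scalar_of1 -scalar_ofB.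
  rewrite modulusM modulus_of distrC ger0_norm ?subr_ge0 ?invf_ge1//.
  have := ler_wpM2l (_ : 0 <= c^-1 - 1) (g0c u); rewrite subr_ge0 invf_ge1// => /(_ c1).
  move=> /le_trans; apply; rewrite mulrA mulrBl mulVf ?gt_eqF// mul1r.
  apply: (@le_trans _ _ (1 - c)); first by rewrite ler_piMr// subr_ge0.
  have : sig ^+ 3 <= sig by rewrite exprS ler_piMr ?(ltW sig0)// exprn_ile1 ?ltW.
  by lra.
- move=> E mE fE u; rewrite gE (_ : g0 _ = 0) ?mulr0//.
  apply: (@modulus_eq0 R k); apply/le_anti; rewrite modulus_ge0 andbT.
  apply: (@le_natSinv _ _ (2 * (nrm (Lres E u) + 1))) => n.
  by have := g0P (Lres E u) n; rewrite -Lres_mul fE sub0r modulusN.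
Qed.

End nearby_state.

(** * Norming pairs and the numerical index *)

Section scalar_supremum.
Context (R : realType) (k : scalar_kind).
Local Notation K := (scalar_field R k).

(** The order of [K] may be partial, so the supremum is computed on the real preimage [B] of [A]. *)
Lemma supremum_scalar_le (A : set K) (c : R) :
  (forall z, A z -> exists2 a : R, z = scalar_of k a & a <= c) -> A !=set0 ->
  supremum 0 A <= scalar_of k c.
Proof.
move=> Ac [z0 Az0]; pose B := [set a | A (scalar_of k a)].
have B0 : B !=set0 by have [a za _] := Ac _ Az0; exists a; rewrite /B /= -za.
have uB : ubound B c by move=> a /Ac[b /scalar_of_inj ->].
have hB : has_sup B by split=> //; exists c.
have sA : supremums A (scalar_of k (sup B)).
  split=> [z Az|z uz].
    have [a za _] := Ac _ Az; rewrite za scalar_of_le.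
    by apply: (sup_upper_bound hB); rewrite /B /= -za.
  have [a za _] := Ac _ Az0.
  (* An upper bound differs from the real element [z0] by a nonnegative scalar, hence is real as
     well. *)
  have zr : z = scalar_of k (modulus (z - scalar_of k a) + a).
    rewrite scalar_ofD -modulusE ger0_norm ?subrK// subr_ge0 -za.
    exact: uz.
  rewrite zr scalar_of_le; apply: ge_sup => // b Bb.
  by rewrite -(scalar_of_le k) -zr; exact: uz.
rewrite /supremum; case: ifPn => [/eqP A0|_]; first by rewrite A0 in Az0.
case: xgetP => [_ -> [_]|/(_ _ sA)//]; apply.
by move=> z /Ac[a -> ac]; rewrite scalar_of_le.
Qed.

(** The default value of [supremum 0] is 0, so the value 1 comes from a genuine least upper
    bound. *)
Lemma supremum1_ub (A : set K) : supremum 0 A = 1 -> ubound A 1.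
Proof.
rewrite /supremum; case: ifPn => [_ /eqP|_]; first by rewrite eq_sym oner_eq0.
case: xgetP => [_ -> [uA _] <-//|_ /eqP]; by rewrite eq_sym oner_eq0.
Qed.

Lemma supremum_max1 (A : set K) : A 1 -> ubound A 1 -> supremum 0 A = 1.
Proof.
move=> A1 uA; have sA : supremums A 1 by split=> // z; apply.
rewrite /supremum; case: ifPn => [/eqP A0|_]; first by rewrite A0 in A1.
by apply: xget_unique => // z; move=> sz; exact: is_subset1_supremums sz sA.
Qed.

Lemma op_norm_le (X : completeNormedModType K) (Y : normedModType K) (f : X -> Y)
    (c : R) : (forall u, `|u| <= 1 -> `|f u| <= scalar_of k c) ->
  op_norm f <= scalar_of k c.
Proof.
move=> fc; apply: supremum_scalar_le; last by exists `|f 0|, 0; rewrite //= normr0.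
move=> _ [u u1 <-]; have := fc u u1.
have -> : `|f u| = scalar_of k (modulus `|f u|) by rewrite -modulusE normr_id.
by rewrite scalar_of_le; exists (modulus `|f u|).
Qed.

End scalar_supremum.

Section norming.
Context (R : realType) (k : scalar_kind).
Context d (T : measurableType d) (mu : {measure set T -> \bar R}).
Local Notation K := (scalar_field R k).
Local Notation X := (Linfty k mu).
Implicit Types (f : {linear X -> K^o}) (u v x : X) (c : R).

Lemma bounded_linear_cont (Y : normedModType K) (f : {linear X -> Y}) c : 0 <= c ->
  (forall u, `|f u| <= scalar_of k (c * nrm u)) -> continuous f.
Proof.
move=> c0 fc; apply: bounded_linear_continuous; apply/bounded_funP => r.
exists (scalar_of k c * r) => u ur; rewrite (le_trans (fc u))//.
by rewrite scalar_ofM -nrmE ler_wpM2l// -(scalar_of0 R k) scalar_of_le.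
Qed.

Lemma norming_pairsI x f : nrm x <= 1 -> bounded_by f 1 -> f x = 1 ->
  norming_pairs (x, f).
Proof.
move=> x1 f1 fx; split=> //=.
- rewrite nrmE -(scalar_of1 R k); congr scalar_of; apply/le_anti; rewrite x1 /=.
  by have := f1 x; rewrite fx mul1r modulus1.
- apply: (@bounded_linear_cont _ _ 1) => // u.
  by rewrite -[`|_|]/(`|f u : K|) modulusE scalar_of_le.
- apply: supremum_max1.
    exists x; rewrite /= ?fx ?normr1// -(scalar_of1 R k) nrm_le_ball.
    exact: x1.
  move=> _ [u u1 <-]; rewrite -[`|_|]/(`|f u : K|) modulusE -(scalar_of1 R k).
  rewrite scalar_of_le; apply: bounded_by_ball => //.
  by rewrite -nrm_le_ball scalar_of1.
Qed.

Lemma norming_pairsE x f : norming_pairs (x, f) ->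
  [/\ nrm x = 1, bounded_by f 1 & f x = 1].
Proof.
move=> [/= x1 _ f1 fx]; split=> //.
  by apply: (@scalar_of_inj R k); rewrite -nrmE x1 scalar_of1.
apply: bounded_byP => u u1; rewrite -(scalar_of_le k) scalar_of1 -modulusE.
apply: (supremum1_ub f1); exists u => //=.
by rewrite -(scalar_of1 R k) nrm_le_ball.
Qed.

Definition opbounded_by (S : X -> X) c := forall u, nrm (S u) <= c * nrm u.

Lemma opbounded_byP (S : {linear X -> X}) c :
  (forall u, nrm u <= 1 -> nrm (S u) <= c) -> opbounded_by S c.
Proof.
move=> Sc u; have [u0|u0] := eqVneq (nrm u) 0.
  by rewrite (nrm_eq0 u0) linear0 nrm0 mulr0.
have un : 0 < nrm u by rewrite lt_neqAle eq_sym u0 nrm_ge0.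
have : nrm (S (scalar_of k (nrm u)^-1 *: u)) <= c.
  by apply: Sc; rewrite nrmZ modulus_of ger0_norm ?invr_ge0 ?nrm_ge0// mulVf.
rewrite linearZ nrmZ modulus_of.
by rewrite ger0_norm ?invr_ge0 ?nrm_ge0// mulrC ler_pdivrMr.
Qed.

(** Compactness enters the estimates through this finite net, which reduces the images of the unit
    ball to finitely many functions. *)
Lemma compact_operator_net (S : {linear X -> X}) (eps : R) :
  compact_operator S -> 0 < eps ->
  exists s : seq X, forall u, nrm u <= 1 -> exists2 w, w \in s & nrm (S u - w) <= eps.
Proof.
rewrite /compact_operator precompactE compact_cover => cS eps0.
have e0 : 0 < scalar_of k eps by rewrite -(scalar_of0 R k) scalar_of_lt.
have [|v Sv|s _ sS] := cS X setT (fun w => interior (ball w (scalar_of k eps))).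
- by move=> w _; exact: open_interior.
- by exists v => //; exact: nbhsx_ballx.
exists (finmap.enum_fset s) => u u1; have : closure (S @` [set x | `|x| <= 1]) (S u).
  by apply: subset_closure; exists u => //=; rewrite -(scalar_of1 R k) nrm_le_ball.
move=> /sS[w ws /interior_subset]; rewrite -ball_normE /= => wu; exists w => //.
by rewrite -nrm_le_ball distrC ltW.
Qed.

Lemma compact_operator_bounded (S : {linear X -> X}) : compact_operator S ->
  exists2 c, 0 <= c & opbounded_by S c.
Proof.
move=> cS; have [s sS] := compact_operator_net cS ltr01.
exists (1 + \sum_(w <- s) nrm w); first by rewrite addr_ge0// sumr_ge0// => w _; exact: nrm_ge0.
apply: opbounded_byP => u /sS[w ws Suw].
rewrite -(subrK w (S u)) (le_trans (nrmD _ _))// lerD//.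
rewrite (perm_big _ (perm_to_rem ws)) /= big_cons lerDl sumr_ge0// => v _.
exact: nrm_ge0.
Qed.

End norming.

(** * Limits along ultrafilters, and the numerical radius as a bound of the norm *)

Section numerical_index.
Context (R : realType) (k : scalar_kind).
Context d (T : measurableType d) (mu : {measure set T -> \bar R}).
Local Notation K := (scalar_field R k).
Local Notation X := (Linfty k mu).
Local Notation one := (Lone k mu).
Implicit Types (f : {linear X -> K^o}) (u v x : X) (c : R) (E : set T).

(** By compactness of [[- C, C]] the image of [U] has a cluster point, and an ultrafilter converges
    to its cluster points. *)
Lemma ultra_bounded_lim (U : set_system T) (r : T -> R) (C : R) : UltraFilter U ->
  U [set t | `|r t| <= C] ->
  exists l, forall e, 0 < e -> U [set t | `|r t - l| <= e].
Proof.
move=> UU rC.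
have rF : U (r @^-1` `[- C, C]%classic).
  by apply: filterS rC => t rt; rewrite /= in_itv /= -ler_norml.
have [l [_ lcl]] := @segment_compact R (- C) C (r @ U) _ rF.
exists l => e e0.
have [//|Ue] := in_ultra_setVsetC [set t | `|r t - l| <= e] UU.
have [||y [/= ey]] := lcl [set y | e < `|y - l|] (ball l e).
- by apply: (@filterS _ U _ _ _ _ Ue) => t /= /negP; rewrite -ltNge.
- exact: nbhsx_ballx.
- by rewrite -ball_normE /= distrC => /ltW; rewrite leNgt ey.
Qed.

(** The functional is the limit along an ultrafilter refining the trace on [E] of the almost
    everywhere filter; this trace is proper because [E] is not null. *)
Lemma character_exists E : ~ (\forall t \ae mu, ~ E t) ->
  exists phi : {linear X -> K^o}, exists2 U : set_system T, ProperFilter U &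
  [/\ U E, almost_everywhere mu `<=` U, state phi &
   forall u e, 0 < e -> U [set t | modulus (ev u t - (phi u : K)) <= e]].
Proof.
move=> E0.
have FF : ProperFilter (within E (almost_everywhere mu)).
  apply: Build_ProperFilter_ex => S FS; apply: contrapT => S0; apply: E0.
  have {}FS : \forall t \ae mu, E t -> S t := FS.
  by apply: filterS FS => t St Et; apply: S0; exists t; exact: St.
have [U [UU FU]] := ultraFilterLemma FF.
have aeU S : (\forall t \ae mu, S t) -> U S.
  by move=> aeS; apply: FU; apply: filterS aeS => t St _.
have UI A B : U A -> U B -> U (A `&` B) by exact: filterI.
have Uex A : U A -> A !=set0 by exact: filter_ex.
have UE : U E by apply: FU; exact: aeW.
have lim u : exists l : K, forall e, 0 < e -> U [set t | modulus (ev u t - l) <= e].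
  have [|x xu] := @ultra_bounded_lim U (fun t => scalar_re (ev u t)) (nrm u) UU.
    by apply: aeU; apply: filterS (ev_le u) => t; apply: le_trans (scalar_re_le _).
  have [|y yu] := @ultra_bounded_lim U (fun t => scalar_im (ev u t)) (nrm u) UU.
    by apply: aeU; apply: filterS (ev_le u) => t; apply: le_trans (scalar_im_le _).
  exists (scalar_mk k x y) => e e0; have e20 : 0 < e / 2 by rewrite divr_gt0.
  apply: filterS2 (xu _ e20) (yu _ e20) => t /= xt yt.
  rewrite (le_trans (modulus_le _))// [leRHS]splitr lerD//.
    by rewrite scalar_reB scalar_re_mk.
  exact: le_trans (scalar_im_mk _ _ _) _.
have [phi0 phi0P] := choice lim.
have close (z : K) (C : R) : 0 < C ->
    (forall e, 0 < e -> modulus z <= C * e) -> z = 0.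
  move=> C0 zC; apply: (@modulus_eq0 R k); apply/le_anti; rewrite modulus_ge0 andbT.
  apply/ler_addgt0Pr => e e0; rewrite add0r -[e](divfK (lt0r_neq0 C0)) mulrC.
  by apply: zC; rewrite divr_gt0.
have lin : linear (phi0 : X -> K^o).
  move=> s u v; apply/eqP; rewrite -subr_eq0; apply/eqP.
  apply: (close _ (modulus s + 2)); first by rewrite ltr_wpDl ?modulus_ge0.
  move=> e e0.
  (* Finitely many sets of [U] have a common point [t], where the limits can be compared through
     actual values. *)
  have /Uex[t [[[tsuv tu] tv] [tD tZ]]] := UI _ _ (UI _ _ (UI _ _
    (phi0P (s *: u + v) _ e0) (phi0P u _ e0)) (phi0P v _ e0))
    (UI _ _ (aeU _ (evD (s *: u) v)) (aeU _ (evZ s u))).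
  rewrite /= tD tZ in tsuv.
  have -> : phi0 (s *: u + v) - (s *: (phi0 u : K^o) + phi0 v) =
    - (s * ev u t + ev v t - phi0 (s *: u + v)) +
    s * (ev u t - phi0 u) + (ev v t - phi0 v).
    by rewrite -[s *: (_ : K^o)]/(s * phi0 u); ring.
  have -> : (modulus s + 2) * e = e + modulus s * e + e by ring.
  rewrite (le_trans (modulusD _ _))// lerD// (le_trans (modulusD _ _))//.
  by rewrite modulusN lerD// modulusM ler_wpM2l ?modulus_ge0.
have [phi phiE] := to_linear lin.
exists phi; exists U; first exact: ultra_proper.
split=> // [|u e e0]; last by rewrite phiE; exact: phi0P.
split=> [u|].
  rewrite mul1r phiE; apply/ler_addgt0Pr => e e0.
  have /Uex[t [tu tn]] := UI _ _ (phi0P u _ e0) (aeU _ (ev_le u)).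
  rewrite -(subrK (ev u t) (phi0 u)) (le_trans (modulusD _ _))// addrC lerD//.
  by rewrite modulusBC.
rewrite phiE; apply/eqP; rewrite -subr_eq0; apply/eqP.
apply: (close _ 1) => // e e0; rewrite mul1r.
have /Uex[t [tu t1]] := UI _ _ (phi0P one _ e0) (aeU _ (ev1 k mu)).
by move: tu; rewrite /= t1 modulusBC.
Qed.

Lemma measurable_ev_near u (a : K) (del : R) :
  measurable [set t | modulus (ev u t - a) <= del].
Proof.
have -> : [set t | modulus (ev u t - a) <= del] =
    (fun t => modulus (ev u t - a)) @^-1` `]-oo, del].
  by apply/seteqP; split => t /=; rewrite in_itv.
rewrite -[X in measurable X]setTI; apply: measurable_modulus => //.
  under eq_fun do rewrite scalar_reB.
  by apply: measurable_funB => //; exact: measurable_ev_re.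
under eq_fun do rewrite scalar_imB.
by apply: measurable_funB => //; exact: measurable_ev_im.
Qed.

Lemma linear_comb_comp (S : {linear X -> X}) f (p q : K) u v :
  f (S (p *: u + q *: v)) = p * f (S u) + q * f (S v) :> K.
Proof. by rewrite [S _]linearP [S (q *: v)]linearZ [f _]linearP [f (q *: _)]linearZ. Qed.

(** Suppose that [S u] exceeds [1 + e] in modulus on a non-null set, and let [phi] be a character
    living there. Where [phi] sees it, [u] is up to [del] a convex combination of two unimodular
    constants, and each of them gives a norming pair with a multiple of [phi]. The a priori bound
    [c] controls the error made inside [S]. *)
Lemma opbounded_by_numerical_radius (S : {linear X -> X}) c : 0 <= c ->
  opbounded_by S c ->
  (forall x f, norming_pairs (x, f) -> modulus (f (S x) : K) <= 1) ->
  opbounded_by S 1.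
Proof.
move=> c0 Sc S1; apply: opbounded_byP => u u1.
(* Replacing [u] by [w] inside [S] costs [c * del], and passing from [phi (S u)] to a value of [S u]
   costs [del]. *)
apply/ler_addgt0Pr => e e0; pose del := e / (c + 1).
have c10 : 0 < c + 1 by rewrite ltr_wpDl.
have del0 : 0 < del by rewrite divr_gt0.
have delE : (c + 1) * del = e by rewrite mulrC divfK ?gt_eqF.
apply/nrm_leP; first by rewrite addr_ge0// ltW.
apply: contrapT => Sue.
have [phi [U UF [UE aeU [phi1 phione] phiP]]] :
    exists phi : {linear X -> K^o}, exists2 U : set_system T, ProperFilter U &
    [/\ U [set t | 1 + e < modulus (ev (S u) t)], almost_everywhere mu `<=` U, state phi &
     forall u e, 0 < e -> U [set t | modulus (ev u t - (phi u : K)) <= e]].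
  apply: character_exists => H; apply: Sue; apply: filterS H => t /= /negP.
  by rewrite -leNgt.
have UI A B : U A -> U B -> U (A `&` B) by exact: filterI.
have Uex A : U A -> A !=set0 by exact: filter_ex.
pose a : K := phi u.
(* This set belongs to [U], so that [phi] ignores what happens off [G]. *)
pose G := [set t | modulus (ev u t - a) <= del].
have mG : measurable G by exact: measurable_ev_near.
have ae_res_in v : \forall t \ae mu, t \in G -> ev (Lres G v) t = ev v t.
  by apply: filterS (ev_res v mG) => t -> ->.
have phiG v : phi (Lres G v) = phi v.
  apply/eqP; rewrite -subr_eq0; apply/eqP; apply: (@modulus_eq0 R k).
  apply/le_anti; rewrite modulus_ge0 andbT; apply/ler_addgt0Pr => r r0; rewrite add0r.
  have r20 : 0 < r / 2 by rewrite divr_gt0.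
  have /Uex[t [[tG tv] [ut /(_ (mem_set ut)) vt]]] := UI _ _
    (UI _ _ (phiP (Lres G v) _ r20) (phiP v _ r20))
    (UI _ _ (phiP u _ del0 : U G) (aeU _ (ae_res_in v))).
  have -> : (phi (Lres G v) : K) - phi v =
      (ev v t - phi v) - (ev (Lres G v) t - phi (Lres G v)) by rewrite vt; ring.
  by rewrite (le_trans (modulusB _ _))// [leRHS]splitr lerD.
have phiGC v : phi (Lres (~` G) v) = 0.
  have := congr1 phi (Lres_setC v mG); rewrite linearD phiG.
  by move=> /(canRL (addKr _)); rewrite addNr.
(* For a unimodular [s], [z s] lies in the unit ball and [s^-1 * phi] takes the value 1 at it. *)
pose z s : X := Lres G (s *: one) + Lres (~` G) u.
have zS (s : K) : modulus s = 1 -> modulus (phi (S (z s)) : K) <= 1.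
  move=> s1; have s0 := modulus1_neq0 s1.
  have lf : linear (fun v => s^-1 * phi v : K^o).
    by move=> r v w; rewrite linearP mulrDr mulrCA.
  have [f fE] := to_linear lf.
  have : norming_pairs (z s, f).
    apply: norming_pairsI.
    - by rewrite nrm_split// nrmZ s1 mul1r nrm1.
    - by move=> v; rewrite fE modulusM modulusV s1 invr1 mul1r mul1r -[leRHS]mul1r.
    - rewrite fE; have -> : phi (z s) = s :> K; last by rewrite mulVf.
      by rewrite linearD phiG phiGC addr0 linearZ phione; exact: mulr1.
  by move=> /S1; rewrite fE modulusM modulusV s1 invr1 mul1r.
have [s0 s01 s0a] := scalar_phase a.
pose r := modulus a; pose lam := s0^-1.
have lam1 : modulus lam = 1 by rewrite modulusV s01 invr1.
have aE : a = scalar_of k r * lam.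
  by rewrite /r -s0a mulrAC mulfV ?mul1r// modulus1_neq0.
have r1 : r <= 1 by rewrite /r (le_trans (phi1 u))// mul1r.
have r0 : 0 <= r by exact: modulus_ge0.
(* As [a = r * lam] and [r = (1 + r) / 2 - (1 - r) / 2], this convex combination equals [a] on [G]
   and [u] off [G]. *)
pose w : X := scalar_of k ((1 + r) / 2) *: z lam + scalar_of k ((1 - r) / 2) *: z (- lam).
have p0 : 0 <= (1 + r) / 2 by rewrite divr_ge0// addr_ge0.
have q0 : 0 <= (1 - r) / 2 by rewrite divr_ge0// subr_ge0.
have Sw : modulus (phi (S w) : K) <= 1.
  have -> : phi (S w) = scalar_of k ((1 + r) / 2) * phi (S (z lam)) +
      scalar_of k ((1 - r) / 2) * phi (S (z (- lam))) :> K by exact: linear_comb_comp.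
  rewrite (le_trans (modulusD _ _))// !modulusM !modulus_of.
  rewrite !ger0_norm//.
  have h1 : modulus (phi (S (z lam)) : K) <= 1 by exact: zS.
  have h2 : modulus (phi (S (z (- lam))) : K) <= 1 by apply: zS; rewrite modulusN.
  have := ler_wpM2l p0 h1; have := ler_wpM2l q0 h2.
  by move: (_ * modulus _) (_ * modulus _) => x y; lra.
have wE : u - w = Lres G (u - a *: one).
  have -> : w = a *: Lres G one + Lres (~` G) u.
    rewrite /w /z !LresZ !scalerDr addrACA !scalerA -!scalerDl.
    have -> : scalar_of k ((1 + r) / 2) * lam + scalar_of k ((1 - r) / 2) * - lam = a.
      by rewrite mulrN -mulrBl -scalar_ofB aE; congr (scalar_of k _ * _); field.
    by rewrite -scalar_ofD (_ : _ / 2 + _ = 1) ?scalar_of1 ?scale1r//; field.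
  by apply/eqP; rewrite subr_eq LresB LresZ addrA subrK Lres_setC.
have uw : nrm (u - w) <= del.
  apply/nrm_leP; first exact: ltW.
  rewrite wE; near=> t; rewrite (near (ev_res (u - a *: one) mG)) //.
  case: ifPn => [|_]; last by rewrite modulus0 ltW.
  rewrite inE (near (evB u (a *: one))) // (near (evZ a one)) //.
  by rewrite (near (ev1 k mu)) // mulr1.
have Su : modulus (phi (S u) : K) <= 1 + c * del.
  rewrite -(subrK w u) linearD linearD (le_trans (modulusD _ _))// addrC lerD//.
  rewrite (le_trans (phi1 _))// mul1r (le_trans (Sc _))// ler_wpM2l//.
have /Uex[t [/= tS]] := UI _ _ UE (phiP (S u) _ del0).
have := modulusD (ev (S u) t - phi (S u)) (phi (S u) : K); rewrite subrK.
by move: tS Su delE; move: (modulus _) (modulus _) (modulus _) => p q s; lra.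
Unshelve. all: by end_near. Qed.

End numerical_index.

(** * Finite partitions and compact operators *)

Section partitions.
Context (R : realType) d (T : measurableType d).

(** A finite measurable partition is encoded by its labelling, so that pairing two codes gives the
    common refinement. *)
Definition measurable_code (I : finType) (c : T -> I) :=
  forall i, measurable (c @^-1` [set i]).

Lemma measurable_code_preimage (I : finType) (c : T -> I) (G : set I) :
  measurable_code c -> measurable (c @^-1` G).
Proof.
move=> mc; have -> : c @^-1` G = \bigcup_(i in G) (c @^-1` [set i]).
  apply/seteqP; split => t /= => [Gt|[i Gi ->]//]; by exists (c t).
apply: fin_bigcup_measurable => //; exact: finite_finset.
Qed.

Lemma measurable_code_pair (I J : finType) (c : T -> I) (c' : T -> J) :
  measurable_code c -> measurable_code c' ->
  measurable_code (fun t => (c t, c' t)).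
Proof.
move=> mc mc' [i j].
have -> : (fun t => (c t, c' t)) @^-1` [set (i, j)] = c @^-1` [set i] `&` c' @^-1` [set j].
  by apply/seteqP; split => t /= [] => [ci cj|-> ->].
exact: measurableI.
Qed.

(** The label of a point records to which of the first [N] sets it belongs. *)
Lemma separating_code (F : nat -> set T) (N : nat) : (forall j, measurable (F j)) ->
  exists (I : finType) (c : T -> I), measurable_code c /\
  forall j t t', (j < N)%N -> c t = c t' -> F j t -> F j t'.
Proof.
move=> mF; elim: N => [|N [I [c [mc cF]]]].
  exists unit, (fun=> tt); split=> // -[].
  by rewrite (_ : _ @^-1` _ = setT)//; apply/seteqP; split.
exists (bool * I)%type, (fun t => (t \in F N, c t)); split.
  apply: (@measurable_code_pair bool I) => // -[].
    rewrite (_ : _ @^-1` _ = F N)//; apply/seteqP; split => t /=; first exact: set_mem.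
    by move=> Ft; rewrite mem_set.
  rewrite (_ : _ @^-1` _ = ~` F N); first exact: measurableC.
  apply/seteqP; split => t /=; first by move=> /negbT; rewrite notin_setE.
  by move=> Ft; rewrite memNset.
move=> j t t'; rewrite ltnS leq_eqVlt => /predU1P[->|jN] [tt' ct] Ft.
  by apply/set_mem; rewrite -tt' mem_set.
exact: cF ct Ft.
Qed.

(** The label records the position of [r t] among levels that are [del] apart and run through
    [[- C, C]]. *)
Lemma oscillation_code_real (r : T -> R) (C del : R) :
  measurable_fun setT r -> 0 < del ->
  exists (I : finType) (c : T -> I), measurable_code c /\
  forall t t', c t = c t' -> `|r t| <= C -> `|r t'| <= C -> `|r t - r t'| <= del.
Proof.
move=> mr del0; pose F j := [set t | r t < j%:R * del - C].
have mF j : measurable (F j).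
  have -> : F j = r @^-1` `]-oo, j%:R * del - C[.
    by apply/seteqP; split => t /=; rewrite in_itv.
  by rewrite -[X in measurable X]setTI; exact: mr.
have [I [c [mc cF]]] := separating_code (Num.truncn (2 * C / del)).+1 mF.
exists I, c; split=> //.
have key t t' : c t = c t' -> `|r t| <= C -> `|r t'| <= C -> r t' <= r t + del.
  move=> ct; rewrite !ler_norml => /andP[tC1 tC2] /andP[tC1' tC2'].
  rewrite leNgt; apply/negP => tt'.
  have x0 : 0 <= (r t' + C) / del by rewrite divr_ge0 ?(ltW del0)//; lra.
  (* If [r t'] exceeded [r t] by more than [del], the last level not above [r t'] would separate the
     two points. *)
  pose j := Num.truncn ((r t' + C) / del).
  have /andP[j1 j2] := truncn_itv x0; rewrite -/j in j1 j2.
  move: j1 j2; rewrite ler_pdivlMr// ltr_pdivrMr// => j1 j2.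
  have jN : (j < (Num.truncn (2 * C / del)).+1)%N.
    by rewrite ltnS; apply: le_truncn; rewrite ler_pM2r ?invr_gt0//; lra.
  have Ft : F j t by rewrite /F /=; move: j2; rewrite -natr1 mulrDl mul1r; lra.
  by have := cF _ _ _ jN ct Ft; rewrite /F /=; lra.
move=> t t' ct tC tC'; have := key _ _ ct tC tC'; have := key _ _ (esym ct) tC' tC.
by rewrite ler_norml => *; apply/andP; split; lra.
Qed.

End partitions.

Section oscillation.
Context (R : realType) (k : scalar_kind).
Context d (T : measurableType d) (mu : {measure set T -> \bar R}).
Local Notation K := (scalar_field R k).
Local Notation X := (Linfty k mu).

Lemma oscillation_code (s : seq X) (del : R) : 0 < del ->
  exists (I : finType) (c : T -> I), measurable_code c /\
  forall w, w \in s -> forall i, exists a : K,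
    \forall t \ae mu, c t = i -> modulus (ev w t - a) <= del.
Proof.
move=> del0; elim: s => [|w s [I [c [mc cP]]]].
  exists unit, (fun=> tt); split=> // -[].
  by rewrite (_ : _ @^-1` _ = setT)//; apply/seteqP; split.
have del20 : 0 < del / 2 by rewrite divr_gt0.
have [I1 [c1 [mc1 c1P]]] := oscillation_code_real (nrm w) (measurable_ev_re w) del20.
have [I2 [c2 [mc2 c2P]]] := oscillation_code_real (nrm w) (measurable_ev_im w) del20.
exists (I1 * I2 * I)%type, (fun t => (c1 t, c2 t, c t)); split.
  by do 2!apply: measurable_code_pair => //.
move=> v; rewrite inE => /predU1P[->|vs] [[i1 i2] i]; last first.
  have [a aP] := cP _ vs i; exists a; apply: filterS aP => t + [_ _].
  exact.
(* A point of the piece at which [w] obeys its essential bound supplies the constant; a piece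
   without such points is null, and any constant will do. *)
pose G := [set t | (c1 t = i1 /\ c2 t = i2) /\ modulus (ev w t) <= nrm w].
have [[t0 [[<- <-] w0]]|G0] := pselect (G !=set0).
  exists (ev w t0); apply: filterS (ev_le w) => t wt [t1 t2 _].
  rewrite (le_trans (modulus_le _))// [leRHS]splitr scalar_reB scalar_imB lerD//.
    by apply: c1P => //; exact: le_trans (scalar_re_le _) _.
  by apply: c2P => //; exact: le_trans (scalar_im_le _) _.
exists 0; apply: filterS (ev_le w) => t wt [t1 t2 _]; exfalso.
by apply: G0; exists t.
Qed.

Lemma ev_sum (I : finType) (P : pred I) (g : I -> X) :
  \forall t \ae mu, ev (\sum_(i | P i) g i) t = \sum_(i | P i) ev (g i) t.
Proof.
elim: (index_enum I) => [|i s IHs].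
  by apply: filterS (ev0 k mu) => t; rewrite !big_nil.
rewrite big_cons; case: ifPn => Pi; near=> t; rewrite big_cons ?Pi ?(negbTE Pi).
  by rewrite (near (evD (g i) (\sum_(j <- s | P j) g j))) // (near IHs).
by rewrite (near IHs).
Unshelve. all: by end_near. Qed.

Lemma Lres_code (I : finType) (c : T -> I) (P : pred I) (E : set T) (u : X) :
  measurable_code c -> measurable E ->
  Lres (c @^-1` [set i | P i] `&` E) u =
  \sum_(i | P i) Lres (c @^-1` [set i] `&` E) u.
Proof.
move=> mc mE; apply: ev_inj.
have mcE i : measurable (c @^-1` [set i] `&` E) by exact: measurableI.
have mcP : measurable (c @^-1` [set i | P i] `&` E).
  by apply: measurableI => //; exact: measurable_code_preimage.
have aei : \forall t \ae mu, forall i, ev (Lres (c @^-1` [set i] `&` E) u) t =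
    if t \in c @^-1` [set i] `&` E then ev u t else 0.
  by apply: filter_forall => i; exact: ev_res.
near=> t; rewrite (near (ev_res u mcP)) //.
rewrite (near (ev_sum P (fun i => Lres (c @^-1` [set i] `&` E) u))) //.
under eq_bigr do rewrite (near aei) // in_setI.
rewrite in_setI; case: (t \in E); last by rewrite andbF big1// => i _; rewrite andbF.
rewrite andbT; case: ifPn => [|/negP ctP].
  rewrite inE /= => ctP; rewrite (bigD1 (c t))//= ifT; last by rewrite andbT inE.
  rewrite big1 ?addr0// => i /andP[_ ict]; rewrite andbT ifF//.
  by apply/negP; rewrite inE /= => cti; rewrite cti eqxx in ict.
rewrite big1// => i Pi; rewrite andbT ifF//; apply/negP; rewrite inE /= => cti.
by apply: ctP; rewrite inE /= cti.
Unshelve. all: by end_near. Qed.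

End oscillation.

(** * Compact maps and finite-rank maps *)

Section compactness.
Context (R : realType) (k : scalar_kind).
Context d (T : measurableType d) (mu : {measure set T -> \bar R}).
Local Notation K := (scalar_field R k).
Local Notation X := (Linfty k mu).
Local Notation ball1 := [set u : X | `|u| <= 1].

Lemma compact_precompactX (A : set X) : compact A -> precompact A.
Proof. apply: compact_precompact; exact: norm_hausdorff. Qed.

Lemma precompactD (A B : set X) : precompact A -> precompact B ->
  precompact [set u | exists2 a, A a & exists2 b, B b & u = a + b].
Proof.
move=> pA pB; have cA : compact (closure A) by rewrite -precompactE.
have cB : compact (closure B) by rewrite -precompactE.
have H : precompact ((fun z : X * X => z.1 + z.2) @` (closure A `*` closure B)).
  apply: compact_precompactX; apply: continuous_compact; last exact: compact_setX.
  by apply: continuous_subspaceT => z; exact: add_continuous.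
apply: precompact_subset H => u [a Aa [b Bb ->]]; exists (a, b) => //.
by split; exact: subset_closure.
Qed.

Lemma precompact_image (L : X -> X) (A : set X) : continuous L ->
  precompact A -> precompact (L @` A).
Proof.
move=> cL pA; have cA : compact (closure A) by rewrite -precompactE.
apply: (precompact_subset _ (compact_precompactX _)).
  by apply: image_subset; exact: subset_closure.
by apply: continuous_compact => //; exact: continuous_subspaceT.
Qed.

Lemma precompact_segment (v : X) (g : R -> K) :
  (forall r s, modulus (g r - g s) <= `|r - s|) ->
  precompact [set g r *: v | r in [set r | `|r| <= 1]].
Proof.
move=> gL; apply: compact_precompactX; apply: continuous_compact; last first.
  rewrite (_ : mkset _ = `[(-1 : R), 1]%classic); first exact: segment_compact.
  by apply/seteqP; split => r /=; rewrite in_itv /= ler_norml.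
apply: continuous_subspaceT => r; apply/(@cvgrPdist_le K) => e e0.
have eE : e = scalar_of k (modulus e) by rewrite -modulusE gtr0_norm.
have re0 : 0 < modulus e / (nrm v + 1).
  by rewrite divr_gt0 ?ltr_wpDl ?nrm_ge0// -(scalar_of_lt k) scalar_of0 -eE.
have : \forall s \near r, `|r - s| <= modulus e / (nrm v + 1).
  by apply: filterS (nbhsx_ballx r _ re0) => s; rewrite -ball_normE => /ltW.
apply: filterS => s rs; rewrite -scalerBl eE nrm_le_ball nrmZ.
rewrite ler_pdivlMr ?ltr_wpDl ?nrm_ge0// in rs.
rewrite (le_trans _ rs)// ler_pM ?modulus_ge0 ?nrm_ge0//.
by rewrite lerDl.
Qed.

(** The real and imaginary parts of [f u] lie in [[-1, 1]], so the image lies in the sum of two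
    compact segments; this treats real and complex scalars at once. *)
Lemma compact_rank1 (f : {linear X -> K^o}) (v : X) : bounded_by f 1 ->
  precompact [set (f u : K) *: v | u in ball1].
Proof.
move=> f1; have Hre := @precompact_segment v (fun r => scalar_mk k r 0).
have Him := @precompact_segment v (fun r => scalar_mk k 0 r).
have mkB (a b a' b' : R) : modulus (scalar_mk k a b - scalar_mk k a' b') <=
    `|a - a'| + `|b - b'|.
  rewrite (le_trans (modulus_le _))// scalar_reB !scalar_re_mk lerD2l.
  by rewrite /scalar_mk; case: (k) => //=; rewrite normr0.
apply: (precompact_subset _ (precompactD (Hre _) (Him _))) => [_ [u u1 <-]|r s|r s].
- have fu : modulus (f u : K) <= 1.
    apply: bounded_by_ball => //; rewrite -(nrm_le_ball u 1) scalar_of1; exact: u1.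
  exists (scalar_mk k (scalar_re (f u : K)) 0 *: v).
    by exists (scalar_re (f u : K)) => //=; exact: le_trans (scalar_re_le _) _.
  exists (scalar_mk k 0 (scalar_im (f u : K)) *: v).
    by exists (scalar_im (f u : K)) => //=; exact: le_trans (scalar_im_le _) _.
  rewrite -scalerDl; congr (_ *: _); apply: scalar_eqP.
    by rewrite scalar_reD !scalar_re_mk addr0.
  rewrite scalar_imD /scalar_mk; case: (k) (f u : scalar_field R k) => [z|[a b]]/=;
    by rewrite add0r.
- by rewrite (le_trans (mkB _ _ _ _))// subrr normr0 addr0.
- by rewrite (le_trans (mkB _ _ _ _))// subrr normr0 add0r.
Qed.

(** The condition of [compact_operator] for maps that are not bundled, so that sums and composites
    can be handled directly. *)
Definition compact_map (S : X -> X) := precompact (S @` ball1).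

Lemma compact_mapD (S1 S2 : X -> X) : compact_map S1 -> compact_map S2 ->
  compact_map (fun u => S1 u + S2 u).
Proof.
move=> c1 c2; apply: precompact_subset (precompactD c1 c2) => _ [u u1 <-].
by exists (S1 u); [exists u|exists (S2 u); [exists u|]].
Qed.

Lemma compact_map_sum (I : finType) (P : pred I) (f : I -> {linear X -> K^o})
    (v : I -> X) : (forall i, P i -> bounded_by (f i) 1) ->
  compact_map (fun u => \sum_(i | P i) (f i u : K) *: v i).
Proof.
move=> f1; elim: (index_enum I) => [|i s IHs].
  apply: precompact_subset (compact_precompactX (@compact_set1 _ (0 : X))).
  by move=> _ [u _ <-]; rewrite big_nil.
have [Pi|Pi] := boolP (P i); last by under eq_fun do rewrite big_cons (negbTE Pi).
under eq_fun do rewrite big_cons Pi.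
by apply: compact_mapD => //; apply: compact_rank1; exact: f1.
Qed.

Lemma compact_map_comp (L S M : X -> X) : continuous L -> compact_map S ->
  (forall u, nrm (M u) <= nrm u) -> compact_map (fun u => L (S (M u))).
Proof.
move=> cL cS M1; apply: precompact_subset (precompact_image cL cS).
move=> _ [u u1 <-]; exists (S (M u)) => //; exists (M u) => //=.
by rewrite (le_trans _ u1)// !nrmE scalar_of_le.
Qed.

End compactness.

(** * The perturbation for a nonnegative [x] *)

Section nonnegative_core.
Context (R : realType) (k : scalar_kind).
Context d (T : measurableType d) (mu : {measure set T -> \bar R}).
Local Notation K := (scalar_field R k).
Local Notation X := (Linfty k mu).
Local Notation one := (Lone k mu).
Implicit Types (f psi : {linear X -> K^o}) (u v x y : X) (E : set T).

Lemma Lres_disjoint E u : measurable E -> Lres E (Lres (~` E) u) = 0.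
Proof.
move=> mE; rewrite LresI ?setICr//; last exact: measurableC.
apply: ev_inj; apply: filterS2 (ev_res u measurable0) (ev0 k mu) => t -> ->.
by rewrite in_set0.
Qed.

Lemma measurable_ev_ge u (a : R) : measurable [set t | a <= modulus (ev u t)].
Proof.
have -> : [set t | a <= modulus (ev u t)] = (fun t => modulus (ev u t)) @^-1` `[a, +oo[.
  by apply/seteqP; split => t /=; rewrite in_itv/= andbT.
rewrite -[X in measurable X]setTI; apply: measurable_modulus => //.
  exact: measurable_ev_re.
exact: measurable_ev_im.
Qed.

Definition nonneg x :=
  \forall t \ae mu, ev x t = scalar_of k (modulus (ev x t)).

Section peak.
Variables (x : X) (beta : R).
Hypotheses (x0 : nonneg x) (x1 : nrm x <= 1) (beta0 : 0 < beta).

Definition peak_set := [set t | 1 - beta <= modulus (ev x t)].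

(** The point [y] of the pair to be built: 1 on the peak set and [x] elsewhere. *)
Definition peaked := x + Lres peak_set (one - x).

Lemma measurable_peak_set : measurable peak_set.
Proof. exact: measurable_ev_ge. Qed.

Lemma nonneg_one_minus :
  \forall t \ae mu, modulus (ev (one - x) t) = 1 - modulus (ev x t).
Proof.
near=> t; rewrite (near (evB one x)) // (near (ev1 k mu)) // (near x0) //.
rewrite -(scalar_of1 R k) -scalar_ofB modulus_of ger0_norm ?subr_ge0.
  by rewrite modulus_of ger0_norm ?modulus_ge0.
by apply: le_trans x1; near: t; exact: ev_le.
Unshelve. all: by end_near. Qed.

Lemma nrm_res_peak_set : nrm (Lres peak_set (one - x)) <= beta.
Proof.
apply/nrm_leP; first exact: ltW.
near=> t; rewrite (near (ev_res (one - x) measurable_peak_set)) //.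
case: ifPn => [|_]; last by rewrite modulus0 ltW.
by rewrite inE /peak_set /= (near nonneg_one_minus) //; lra.
Unshelve. all: by end_near. Qed.

Lemma peaked_dist : nrm (x - peaked) <= beta.
Proof. by rewrite /peaked opprD addNKr nrmN nrm_res_peak_set. Qed.

(** In this form a functional that vanishes off the peak set visibly has the same value at [peaked]
    and at [one]. *)
Lemma peakedE : peaked = one - Lres (~` peak_set) (one - x).
Proof.
have xE := Lres_setC (one - x) measurable_peak_set.
rewrite /peaked; move: xE; set a := Lres _ _; set b := Lres _ _ => ab.
by apply/eqP; rewrite eq_sym subr_eq -addrA ab addrC subrK.
Qed.

Lemma nrm_peaked : nrm peaked <= 1.
Proof.
apply/nrm_leP => //; near=> t; rewrite /peaked.
rewrite (near (evD x (Lres peak_set (one - x)))) //.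
rewrite (near (ev_res (one - x) measurable_peak_set)) //.
have xt : modulus (ev x t) <= 1 by apply: le_trans x1; near: t; exact: ev_le.
case: ifPn => _; last by rewrite addr0.
rewrite (le_trans (modulusD _ _))// (near nonneg_one_minus) //.
by move: xt; move: (modulus _) => p; lra.
Unshelve. all: by end_near. Qed.

Lemma small_off_peak_set f (tau : R) : bounded_by f 1 ->
  1 - tau <= scalar_re (f x : K) ->
  forall u, modulus (f (Lres (~` peak_set) u) : K) <= tau / beta * nrm u.
Proof.
move=> f1 fx u; have mB := measurable_peak_set.
pose F := f \o Lres (~` peak_set).
have [G GE] := @to_linear K X K^o F (@linearP _ _ _ _ F).
rewrite -[f _]/(F u) -GE; apply: bounded_byP => {}u u1; rewrite GE /F /=.
rewrite ler_pdivlMr// mulrC; apply: (small_off_peak (a := x) (c := 1)) => //.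
- exact: measurableC.
- exact: ltW.
- near=> t; rewrite in_setC; case: ifPn => [|_].
    by rewrite notin_setE /peak_set /= => /negP; rewrite -ltNge => /ltW.
  by apply: le_trans x1; near: t; exact: ev_le.
Unshelve. all: by end_near. Qed.

(** As [x] is nonnegative, [x + s *: (one - x)] stays in the unit ball for every unimodular [s]. For
    a suitable [s] the value of [psi] there is [1 + |psi (one - x)|], so [psi (one - x)]
    vanishes. *)
Lemma state_at_nonneg psi : bounded_by psi 1 -> psi x = 1 -> state psi.
Proof.
move=> psi1 psix; split=> //; have [s s1 ps] := functional_phase psi (one - x).
have : nrm (x + s *: (one - x)) <= 1.
  apply/nrm_leP => //; near=> t.
  rewrite (near (evD x (s *: (one - x)))) // (near (evZ s (one - x))) //.
  rewrite (le_trans (modulusD _ _))// modulusM s1 mul1r (near nonneg_one_minus) //.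
  by move: (modulus _) => p; lra.
move=> /(bounded_by_ball ler01 psi1); rewrite linearD psix ps.
rewrite -[X in modulus X]/(1 + scalar_of k _ : K) -(scalar_of1 R k) -scalar_ofD modulus_of.
rewrite ger0_norm ?addr_ge0 ?modulus_ge0// gerDl => p0.
have : psi (one - x) = 0 :> K.
  by apply: (@modulus_eq0 R k); apply/le_anti; rewrite p0 modulus_ge0.
by rewrite linearB psix => /subr0_eq ->; rewrite scalar_of1.
Unshelve. all: by end_near. Qed.

Lemma mass_off_peak_set psi : bounded_by psi 1 -> psi x = 1 ->
  forall u, psi (Lres (~` peak_set) u) = 0.
Proof.
move=> psi1 psix u; apply: (@modulus_eq0 R k); apply/le_anti; rewrite modulus_ge0 andbT.
have := @small_off_peak_set psi 0 psi1; rewrite psix => /(_ _ u).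
rewrite !mul0r; apply.
by rewrite subr0 -[X in scalar_re X](scalar_of1 R k) scalar_re_of.
Qed.

(** The nearby state is taken for [f] cut to the peak set; it vanishes off that set, hence is 1 at
    [peaked]. The three terms bounded by [sig ^+ 3] are the deficit of [f] at [x], the part of [f]
    off the peak set and the distance from [x] to [one] on it. *)
Lemma state_attaining f (tau sig : R) : bounded_by f 1 ->
  1 - tau <= scalar_re (f x : K) -> 0 < sig < 1 ->
  tau + tau / beta + beta <= sig ^+ 3 ->
  exists g, [/\ state g, g peaked = 1 &
    forall u, modulus (f u - g u : K) <= (18 * sig + tau / beta) * nrm u].
Proof.
move=> f1 fx sig01 tbs; have mB := measurable_peak_set.
pose F := f \o Lres peak_set.
have [G GE] := @to_linear K X K^o F (@linearP _ _ _ _ F).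
have G1 : bounded_by G 1.
  by move=> u; rewrite GE /F /= (le_trans (f1 _))// !mul1r nrm_res.
have off := small_off_peak_set f1 fx.
have Gone : 1 - sig ^+ 3 <= scalar_re (G one : K).
  have -> : G one = (f x : K) - f (Lres (~` peak_set) x) + f (Lres peak_set (one - x)).
    rewrite GE /F /= -{1}(Lres_setC x mB) linearD LresB linearB.
    have cancel (a b c : K) : a = b + c - c + (a - b) by ring.
    exact: cancel.
  rewrite scalar_reD scalar_reB.
  have h1 := le_trans (scalar_re_le_modulus _) (off x).
  have h2 : - scalar_re (f (Lres peak_set (one - x)) : K) <= beta.
    rewrite -scalar_reN (le_trans (scalar_re_le_modulus _))// modulusN.
    by rewrite (le_trans (f1 _))// mul1r nrm_res_peak_set.
  have tau0 : 0 <= tau / beta.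
    rewrite divr_ge0 ?(ltW beta0)//.
    have := le_trans (scalar_re_le_modulus _) (bounded_by_ball ler01 f1 x1).
    by move: fx; move: (scalar_re _) => p; lra.
  have h3 := ler_wpM2l tau0 x1.
  move: h1 h2 h3 fx tbs; move: (scalar_re _) (scalar_re _) (scalar_re _) => a b c.
  by move: (tau / beta * nrm x) (tau / beta) => p q; lra.
have [g [gS gG gE]] := nearby_state G1 sig01 Gone.
exists g; split=> //.
- rewrite peakedE linearB gE ?subr0; [by case: gS|exact: measurableC|].
  by move=> u; rewrite GE /F /= Lres_disjoint// linear0.
- move=> u; have -> : (f u : K) - g u = (G u - g u) + f (Lres (~` peak_set) u).
    rewrite GE /F /= -{1}(Lres_setC u mB) linearD.
    have swap (a b c : K) : a + b - c = a - c + b by ring.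
    exact: swap.
  by rewrite mulrDl (le_trans (modulusD _ _))// lerD.
Qed.

End peak.

End nonnegative_core.

(** * Replacing an operator by states on the pieces of a partition *)

Section surgery.
Context (R : realType) (k : scalar_kind).
Context d (T : measurableType d) (mu : {measure set T -> \bar R}).
Local Notation K := (scalar_field R k).
Local Notation X := (Linfty k mu).
Local Notation one := (Lone k mu).
Implicit Types (f psi : {linear X -> K^o}) (u v x y : X) (E D : set T).

(** The new operator is a restriction of [S0] plus a finite-rank operator, so compactness
    survives. *)
Lemma replace_on_code (I : finType) (c : T -> I) (P : pred I) D
    (s : I -> {linear X -> K^o}) (S0 : {linear X -> X}) :
  measurable_code c -> measurable D -> (forall i, P i -> bounded_by (s i) 1) ->
  exists S : {linear X -> X},
    (forall u, \forall t \ae mu, ev (S u) t =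
       if t \in c @^-1` [set i | P i] `&` D then (s (c t) u : K) else ev (S0 u) t) /\
    (compact_operator S0 -> compact_operator S).
Proof.
move=> mc mD s1; set D' := _ `&` D.
have mD' : measurable D' by apply: measurableI => //; exact: measurable_code_preimage.
have mP i : measurable (c @^-1` [set i] `&` D) by exact: measurableI.
pose F u : X := Lres (~` D') (S0 u) +
  \sum_(i | P i) (s i u : K) *: Lres (c @^-1` [set i] `&` D) one.
have linF : linear F.
  move=> a u v; rewrite /F linearP LresD LresZ scalerDr addrACA; congr (_ + _).
  rewrite scaler_sumr -big_split; apply: eq_bigr => i _ /=.
  by rewrite linearP scalerDl scalerA.
have [S SE] := to_linear linF; exists S; split=> [u|cS0].
  have aei : \forall t \ae mu, forall i,
      ev ((s i u : K) *: Lres (c @^-1` [set i] `&` D) one) t =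
      if t \in c @^-1` [set i] `&` D then (s i u : K) else 0.
    apply: filter_forall => i; near=> t.
    rewrite (near (evZ (s i u : K) (Lres (c @^-1` [set i] `&` D) one))) //.
    rewrite (near (ev_res one (mP i))) //; case: ifP => _; last by rewrite mulr0.
    by rewrite (near (ev1 k mu)) // mulr1.
  near=> t; rewrite SE /F.
  rewrite (near (evD (Lres (~` D') (S0 u))
    (\sum_(i | P i) (s i u : K) *: Lres (c @^-1` [set i] `&` D) one))) //.
  rewrite (near (ev_res (S0 u) (measurableC mD'))) //.
  rewrite (near (ev_sum P (fun i => (s i u : K) *: Lres (c @^-1` [set i] `&` D) one))) //.
  under eq_bigr do rewrite (near aei) //.
  rewrite in_setC; have [tD'|tD'] := boolP (t \in D') => /=.
    have [/= cP Dt] := set_mem tD'.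
    rewrite add0r (bigD1 (c t)) //= mem_set // big1 ?addr0 // => i /andP[_ ict].
    by rewrite memNset // => -[/= cti]; rewrite cti eqxx in ict.
  rewrite big1 ?addr0// => i Pi; rewrite memNset // => -[/= cti Dt].
  by move: tD'; rewrite notin_setE; apply; split=> //=; rewrite cti.
have -> : compact_operator S = compact_map F.
  by rewrite /compact_operator /compact_map; congr (precompact (_ @` _)); exact/funext.
apply: compact_mapD; last exact: compact_map_sum.
apply: (compact_map_comp (M := id)) => //.
apply: (@bounded_linear_cont _ _ _ _ _ _ (Lres (~` D')) 1) => // v.
by rewrite mul1r nrm_le_ball; apply: nrm_res; exact: measurableC.
Unshelve. all: by end_near. Qed.

(** Conditioning requires pieces of positive mass; by finite additivity, dropping the others loses
    nothing. *)
Lemma mass_code psi (I : finType) (c : T -> I) D : state psi ->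
  measurable_code c -> measurable D ->
  mass psi (c @^-1` [set i | 0 < mass psi (c @^-1` [set i] `&` D)] `&` D) = mass psi D.
Proof.
move=> psiS mc mD; have mP i : measurable (c @^-1` [set i] `&` D) by exact: measurableI.
have massE (P : pred I) : mass psi (c @^-1` [set i | P i] `&` D) =
    \sum_(i | P i) mass psi (c @^-1` [set i] `&` D).
  rewrite /mass Lres_code// linear_sum /=.
  by elim/big_rec2: _ => [|i y1 y2 _ <-]; rewrite ?scalar_re0// -scalar_reD.
rewrite massE -[in RHS](setTI D) -(preimage_setT c).
rewrite -[setT](_ : [set i | xpredT i] = _); last by apply/seteqP; split.
rewrite massE big_mkcond; apply: eq_bigr => i _ /=; case: ifPn => // /negP mi.
apply/eqP; rewrite eq_sym eq_le mass_ge0// andbT leNgt; exact/negP.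
Qed.

(** The average of [S0 u] under [psi] conditioned on [E] is a functional of [u] with real part at
    least [1 - tau] at [x], to which [state_attaining] applies. If [S0 u] is almost a constant [a]
    on [E], its average is close to [a], and so is the value of the state. *)
Lemma averaged_state (S0 : {linear X -> X}) psi x (beta tau sig : R) E :
  opbounded_by S0 1 -> state psi -> nonneg x -> nrm x <= 1 -> 0 < beta ->
  0 < sig < 1 -> 0 <= tau -> tau + tau / beta + beta <= sig ^+ 3 ->
  measurable E -> 0 < mass psi E ->
  (forall t, E t -> modulus (ev (S0 x) t - ev one t) <= tau) ->
  exists g, [/\ state g, g (peaked x beta) = 1 &
    forall u (a : K) (del : R), 0 <= del ->
      (\forall t \ae mu, E t -> modulus (ev (S0 u) t - a) <= del) ->
      modulus ((g u : K) - a) <= del + (18 * sig + tau / beta) * nrm u].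
Proof.
move=> S01 psiS x0 x1 beta0 sig01 tau0 tbs mE E0 Etau.
have [phi [[phi1 phione] phiE _]] := cond_state psiS mE E0.
have phires v : phi (Lres E v) = phi v by rewrite !phiE LresI// setIid.
have near_avg v (a : K) (del : R) : 0 <= del ->
    (\forall t \ae mu, E t -> modulus (ev v t - a) <= del) ->
    modulus ((phi v : K) - a) <= del.
  move=> del0 va.
  have -> : (phi v : K) - a = phi (Lres E (v - a *: one)).
    rewrite phires linearB linearZ phione; congr (_ - _).
    by rewrite -[LHS]mulr1.
  rewrite (le_trans (phi1 _))// mul1r; apply/nrm_leP => //; near=> t.
  rewrite (near (ev_res (v - a *: one) mE)) //.
  case: ifPn => [|_]; last by rewrite modulus0.
  rewrite inE (near (evB v (a *: one))) // (near (evZ a one)) //.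
  by rewrite (near (ev1 k mu)) // mulr1; near: t.
pose F := phi \o S0.
have [G GE] := @to_linear K X K^o F (@linearP _ _ _ _ F).
have G1 : bounded_by G 1.
  by move=> u; rewrite GE /F /= (le_trans (phi1 _))// !mul1r -[leRHS]mul1r S01.
have Gx : 1 - tau <= scalar_re (G x : K).
  have : modulus ((phi (S0 x) : K) - 1) <= tau.
    apply: near_avg => //; apply: filterS (ev1 k mu) => t t1 Et.
    by rewrite -t1; exact: Etau.
  rewrite GE /F /= modulusBC => /(le_trans (scalar_re_le_modulus _)).
  rewrite scalar_reB -[X in scalar_re X - _](scalar_of1 R k) scalar_re_of.
  by move: (scalar_re _) => p; lra.
have [g [gS gy gG]] := state_attaining x0 x1 beta0 G1 Gx sig01 tbs.
exists g; split=> // u a del del0 ua.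
have -> : (g u : K) - a = ((phi (S0 u) : K) - a) - ((phi (S0 u) : K) - g u) by ring.
rewrite (le_trans (modulusB _ _))// lerD//; first exact: near_avg.
by have := gG u; rewrite GE.
Unshelve. all: by end_near. Qed.

(** The choice is [sig = e / 100], [beta = sig ^+ 3 / 4] and [tau = beta * beta]. Then
    [tau / beta = beta], and the requirements follow from [tau <= beta <= sig]. *)
Lemma perturbation_scales (e : R) : 0 < e < 1 ->
  exists sig beta tau : R, [/\ 0 < sig < 1, 0 < beta, 0 < tau < 1,
    tau + tau / beta + beta <= sig ^+ 3 &
    beta <= e / 2 /\ 22 * sig + tau / beta <= e / 2].
Proof.
move=> /andP[e0 e1]; have [sig [sig0 sig1 sigE]] : exists s : R, [/\ 0 < s, s < 1 & 100 * s = e].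
  by exists (e / 100); split; lra.
have [p [p0 ps sig3]] : exists p : R, [/\ 0 < p, p <= sig & 4 * p = sig ^+ 3].
  exists (sig ^+ 3 / 4); have : sig ^+ 3 <= sig.
    by rewrite exprS ler_piMr ?(ltW sig0)// exprn_ile1 ?ltW.
  by have : 0 < sig ^+ 3 by [exact: exprn_gt0]; move: (sig ^+ 3) => q *; split; lra.
have pp : p * p <= p by rewrite ler_piMl ?ltW//; lra.
exists sig, p, (p * p); rewrite sig0 sig1 p0 mulr_gt0// mulfK ?gt_eqF// -sig3.
by split=> //; [|lra|split]; lra.
Qed.

Lemma nonnegative_BPBp_nu (e : R) : 0 < e < 1 -> exists2 eta : R, 0 < eta < 1 &
  forall (S0 : {linear X -> X}) x psi,
    compact_operator S0 -> opbounded_by S0 1 -> nonneg x -> nrm x <= 1 ->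
    bounded_by psi 1 -> psi x = 1 -> 1 - eta <= scalar_re (psi (S0 x) : K) ->
  exists (S : {linear X -> X}) y psi',
    [/\ compact_operator S, opbounded_by S 1,
        [/\ nrm y <= 1, bounded_by psi' 1, psi' y = 1 & psi' (S y) = 1],
        (forall u, nrm (S0 u - S u) <= e / 2 * nrm u) &
        nrm (x - y) <= e / 2 /\
        forall u, modulus ((psi u : K) - psi' u) <= e / 2 * nrm u].
Proof.
move=> e01; have [sig [beta [tau [sig01 beta0 /andP[tau0 tau1] tbs [beta_e kap_e]]]]] :=
  perturbation_scales e01.
have [e0 e1] := andP e01; have [sig0 sig1] := andP sig01.
(* By [small_off_two_peaks], this [eta] leaves a mass of at most [8 * eta / tau ^+ 2 = e / 8] to the
   set where [S0 x] is [tau] away from 1. *)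
exists (tau ^+ 2 * e / 64).
  have t0 : 0 < tau ^+ 2 * e by rewrite mulr_gt0// exprn_gt0.
  have t1 : tau ^+ 2 * e <= 1 by rewrite mulr_ile1 ?exprn_ile1 ?ltW ?exprn_gt0.
  by move: t0 t1; move: (_ * e) => t; lra.
move=> S0 x psi cS0 S01 x0 x1 psi1 psix psiS0.
have psiS := state_at_nonneg x0 x1 psi1 psix.
have [s sP] := compact_operator_net cS0 sig0.
have [I [c [mc cP]]] := oscillation_code s sig0.
pose Dc := [set t | tau <= modulus (ev (S0 x) t - ev one t)].
have mDc : measurable Dc by exact: measurable_modulus_ge.
have mD : measurable (~` Dc) by exact: measurableC.
pose pc i := c @^-1` [set i] `&` ~` Dc.
have mpc i : measurable (pc i) by exact: measurableI.
pose good := [pred i | 0 < mass psi (pc i)].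
pose D' := c @^-1` [set i | good i] `&` ~` Dc.
have mD' : measurable D' by apply: measurableI => //; exact: measurable_code_preimage.
pose y := peaked x beta.
have /choice[g gP] i : exists g : {linear X -> K^o}, good i ->
    [/\ state g, g y = 1 &
    forall u (a : K) (del : R), 0 <= del ->
      (\forall t \ae mu, pc i t -> modulus (ev (S0 u) t - a) <= del) ->
      modulus ((g u : K) - a) <= del + (18 * sig + tau / beta) * nrm u].
  (* On a piece without mass any functional will do, since [S0] is left unchanged there. *)
  have [gi|] := boolP (good i); last by exists psi.
  have [t [_ /= /negP]|h gh] := averaged_state S01 psiS x0 x1 beta0 sig01 (ltW tau0) tbs (mpc i) gi.
    by rewrite -ltNge => /ltW.
  by exists h.
have [S [SE cS]] := @replace_on_code I c good (~` Dc) g S0 mc mD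
  (fun i gi => let: And3 (conj b _) _ _ := gP i gi in b).
have q_ge : 1 - e / 8 <= mass psi D'.
  rewrite /D' (mass_code psiS mc mD).
  have Dc_le : modulus (psi (Lres Dc one) : K) <= e / 8.
    have S0x1 : nrm (S0 x) <= 1 by rewrite (le_trans (S01 x))// mul1r.
    have psione : 1 - tau ^+ 2 * e / 64 <= scalar_re (psi one : K).
      case: psiS => _ ->; rewrite -[X in scalar_re X](scalar_of1 R k) scalar_re_of.
      by rewrite gerBl divr_ge0// mulr_ge0 ?sqr_ge0// ltW.
    have := small_off_two_peaks ler01 psi1 tau0 S0x1 (nrm1 k mu) psiS0 psione (nrm1 k mu).
    rewrite -/Dc (_ : 8 * _ / _ = e / 8)//.
    by field; rewrite gt_eqF.
  have := massC psiS mDc; rewrite -(mass_modulus psiS mDc) in Dc_le.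
  by move: Dc_le; move: (mass _ _) (mass _ _) => m1 m2; lra.
have q0 : 0 < mass psi D' by move: q_ge; move: (mass _ _) => m; lra.
have [psi' [[psi'1 psi'one] psi'E psi'dist]] := cond_state psiS mD' q0.
(* The states on the good pieces are all 1 at [y], so [S y] is 1 on [D'], where [psi'] lives. *)
have Sy : psi' (S y) = 1.
  have SyD' : Lres D' (S y) = Lres D' one.
    apply: ev_inj; near=> t.
    rewrite (near (ev_res (S y) mD')) // (near (ev_res one mD')) // (near (ev1 k mu)) //.
    case: ifPn => // tD'; rewrite (near (SE y)) // -/D' tD'.
    by have /set_mem[/= /gP[_ ->]] := tD'.
  by rewrite psi'E SyD' -psi'E.
(* [psi] vanishes off the peak set and conditioning preserves this, so [psi'] has the same value at
   [y] and at [one]. *)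
have psi'y : psi' y = 1.
  rewrite /y (peakedE x beta) linearB psi'one.
  suff -> : psi' (Lres (~` peak_set x beta) (one - x)) = 0 by rewrite subr0.
  have mB : measurable (~` peak_set x beta) by apply: measurableC; exact: measurable_peak_set.
  rewrite psi'E LresI// setIC -LresI// (mass_off_peak_set x1 beta0 psi1 psix).
  exact: mulr0.
have S1 : opbounded_by S 1.
  move=> u; rewrite mul1r; apply/nrm_leP; first exact: nrm_ge0.
  near=> t; rewrite (near (SE u)) //; case: ifPn => [/set_mem[/= /gP[[g1 _] _ _] _]|_].
    by rewrite (le_trans (g1 _))// mul1r.
  rewrite (@le_trans _ _ (nrm (S0 u)))//; first by near: t; exact: ev_le.
  by rewrite -[leRHS]mul1r S01.
exists S, y, psi'; split=> //.
- exact: cS.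
- by split=> //; exact: nrm_peaked.
- have lind : linear (fun u => S0 u - S u).
    by move=> a u v; rewrite !linearP /= addrACA -scalerDr.
  have [F FE] := to_linear lind.
  move=> u; rewrite -[S0 u - _]FE; apply: opbounded_byP => {}u u1; rewrite FE.
  have [w ws wu] := sP u u1.
  have /choice[a aP] := cP w ws.
  have aeP : \forall t \ae mu, forall i, c t = i -> modulus (ev w t - a i) <= sig.
    by apply: filter_forall => i; exact: aP.
  (* One [sig] comes from the net and one from the oscillation on the pieces. *)
  have aeS : \forall t \ae mu, modulus (ev (S0 u) t - a (c t)) <= 2 * sig.
    near=> t; have -> : ev (S0 u) t - a (c t) = (ev (S0 u) t - ev w t) + (ev w t - a (c t)).
      by rewrite addrA subrK.
    rewrite (le_trans (modulusD _ _))// mulr2n mulrDl mul1r lerD//.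
      rewrite -(near (evB (S0 u) w)) // (le_trans _ wu)//.
      by near: t; exact: ev_le.
    by apply: (near aeP).
  (* The [2 * sig] above joins the [18 * sig] of the nearby state; comparing [S0 u] with [a] once
     more then gives [22 * sig]. *)
  have gS i : good i -> modulus ((g i u : K) - a i) <= 20 * sig + tau / beta.
    move=> /gP[_ _ /(_ u (a i) (2 * sig))] H.
    apply: (le_trans (H _ _)).
    - by rewrite mulr_ge0// ltW.
    - by apply: filterS aeS => t + [/= cti _]; rewrite cti.
    - have kap0 : 0 <= 18 * sig + tau / beta.
        by apply: addr_ge0; apply: ltW; [exact: mulr_gt0|exact: divr_gt0].
      have -> : 20 * sig = 2 * sig + 18 * sig by ring.
      by rewrite -addrA lerD2l ler_piMr.
  apply/nrm_leP; first by rewrite divr_ge0// ltW.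
  near=> t; rewrite (near (evB (S0 u) (S u))) // (near (SE u)) //.
  case: ifPn => [/set_mem[/= gct _]|_]; last by rewrite subrr modulus0 divr_ge0 ?ltW.
  have -> : ev (S0 u) t - (g (c t) u : K) =
      (ev (S0 u) t - a (c t)) - ((g (c t) u : K) - a (c t)) by ring.
  rewrite (le_trans (modulusB _ _))// (le_trans _ kap_e)//.
  have -> : 22 * sig = 2 * sig + 20 * sig by ring.
  by rewrite -addrA lerD ?gS//; near: t.
- split=> [|u].
    by rewrite (le_trans (peaked_dist x0 x1 beta0)).
  (* Conditioning doubles the lost mass [e / 8], which stays below [e / 2]. *)
  apply: (le_trans (psi'dist u)); apply: ler_wpM2r; first exact: nrm_ge0.
  by move: q_ge; move: (mass _ _) => m; lra.
Unshelve. all: by end_near. Qed.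

End surgery.

(** * Reduction to a nonnegative [x] *)

Section polar.
Context (R : realType) (k : scalar_kind).
Context d (T : measurableType d) (mu : {measure set T -> \bar R}).
Local Notation K := (scalar_field R k).
Local Notation X := (Linfty k mu).
Local Notation one := (Lone k mu).

Definition scalar_conj (z : K) : K := scalar_mk k (scalar_re z) (- scalar_im z).

Lemma scalar_re_conj z : scalar_re (scalar_conj z) = scalar_re z.
Proof. exact: scalar_re_mk. Qed.

Lemma scalar_im_conj z : scalar_im (scalar_conj z) = - scalar_im z.
Proof. by rewrite /scalar_conj /scalar_mk; case: (k) z => //= z; rewrite oppr0. Qed.

Lemma mul_scalar_conj z : z * scalar_conj z = scalar_of k (modulus z ^+ 2).
Proof.
apply: scalar_eqP; rewrite ?scalar_re_of ?scalar_im_of.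
  by rewrite scalar_reM scalar_re_conj scalar_im_conj modulus_sqr; ring.
by rewrite scalar_imM scalar_re_conj scalar_im_conj; ring.
Qed.

Lemma modulus_conj z : modulus (scalar_conj z) = modulus z.
Proof.
apply/eqP; rewrite -(@eqrXn2 _ 2) ?modulus_ge0// !modulus_sqr.
by rewrite scalar_re_conj scalar_im_conj sqrrN.
Qed.

(** The phase of [x] is set to 1 where [x] vanishes, so that it is unimodular everywhere;
    multiplication by it is then an isometry of [X], inverted by multiplication by its conjugate. *)
Lemma polar (x : X) : exists m mb : X, [/\ nrm m <= 1, nrm mb <= 1,
  Lmul m mb = one & nonneg (Lmul mb x)].
Proof.
pose r t := modulus (ev x t).
have mr : measurable_fun setT r.
  by apply: measurable_modulus; [exact: measurable_ev_re|exact: measurable_ev_im].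
have mV : measurable_fun setT (fun t => (r t)^-1).
  under eq_fun do rewrite -powR_inv1 ?modulus_ge0//.
  exact: measurableT_comp (measurable_powR _) mr.
pose f t : K := if r t == 0 then 1 else ev x t * scalar_of k (r t)^-1.
have f1 t : modulus (f t) = 1.
  rewrite /f; case: ifPn => [_|r0]; first exact: modulus1.
  by rewrite modulusM modulus_of ger0_norm ?invr_ge0 ?modulus_ge0// divff.
have mre : measurable_fun setT (fun t => scalar_re (f t)).
  rewrite (_ : (fun t => _) =
    fun t => if r t == 0 then 1 else scalar_re (ev x t) * (r t)^-1); last first.
    apply/funext => t; rewrite /f; case: ifP => _.
      by rewrite -[X in scalar_re X](scalar_of1 R k) scalar_re_of.
    by rewrite scalar_reM scalar_re_of scalar_im_of mulr0 subr0.
  apply: measurable_fun_ifT => //; first exact: measurable_fun_eqr.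
  by apply: measurable_funM => //; exact: measurable_ev_re.
have mim : measurable_fun setT (fun t => scalar_im (f t)).
  rewrite (_ : (fun t => _) =
    fun t => if r t == 0 then 0 else scalar_im (ev x t) * (r t)^-1); last first.
    apply/funext => t; rewrite /f; case: ifP => _.
      by rewrite -[X in scalar_im X](scalar_of1 R k) scalar_im_of.
    by rewrite scalar_imM scalar_re_of scalar_im_of mulr0 add0r.
  apply: measurable_fun_ifT => //; first exact: measurable_fun_eqr.
  by apply: measurable_funM => //; exact: measurable_ev_im.
have fL : is_Linfty_fun mu f.
  by split=> //; apply/Linfty_norm_finP; exists 1 => //; apply: aeW => t; rewrite f1.
have fbL : is_Linfty_fun mu (scalar_conj \o f).
  split.
  - by under eq_fun do rewrite /= scalar_re_conj.
  - by under eq_fun do rewrite /= scalar_im_conj; exact: measurableT_comp.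
  - apply/Linfty_norm_finP; exists 1 => //; apply: aeW => t.
    by rewrite /= modulus_conj f1.
exists (Lmk mu f), (Lmk mu (scalar_conj \o f)); split.
- by apply/nrm_leP => //; apply: filterS (ev_Lmk fL) => t ->; rewrite f1.
- by apply/nrm_leP => //; apply: filterS (ev_Lmk fbL) => t ->; rewrite /= modulus_conj f1.
- apply: ev_inj; near=> t; rewrite (near (evM (Lmk mu f) (Lmk mu (scalar_conj \o f)))) //.
  rewrite (near (ev_Lmk fL)) // (near (ev_Lmk fbL)) // (near (ev1 k mu)) //=.
  by rewrite mul_scalar_conj f1 expr1n scalar_of1.
- rewrite /nonneg; near=> t.
  rewrite (near (evM (Lmk mu (scalar_conj \o f)) x)) // (near (ev_Lmk fbL)) //=.
  rewrite modulusM modulus_conj f1 mul1r.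
  have := mul_scalar_conj (f t); rewrite f1 expr1n scalar_of1 /f.
  have [r0|r0] := eqVneq (r t) 0.
    by rewrite (modulus_eq0 r0) mulr0 modulus0 scalar_of0.
  rewrite -/(r t) => ff; have : scalar_of k (r t) != 0.
    by apply: contra_neq r0 => /(congr1 (@scalar_re R k)); rewrite scalar_re_of scalar_re0.
  move=> rK; rewrite -[RHS]mulr1 -[X in _ = _ * X]ff scalar_ofV.
  rewrite [ev x t / _]mulrC !mulrA divff// mul1r; exact: mulrC.
Unshelve. all: by end_near. Qed.

Lemma compact_map_Lmul (F : X -> X) (s : K) (m m' : X) :
  modulus s = 1 -> nrm m <= 1 -> nrm m' <= 1 -> compact_map F ->
  compact_map (fun u => s *: Lmul m (F (Lmul m' u))).
Proof.
move=> s1 m1 m'1 cF.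
have -> : (fun u => s *: Lmul m (F (Lmul m' u))) =
    (fun u => Lmul (s *: m) (F (Lmul m' u))).
  by apply/funext => u; rewrite LmulC -LmulZr LmulC.
apply: (compact_map_comp (M := Lmul m')) => //; last by move=> u; exact: nrmM1.
apply: (@bounded_linear_cont _ _ _ _ _ _ (Lmul (s *: m)) 1) => // u.
by rewrite mul1r nrm_le_ball nrmM1// nrmZ s1 mul1r.
Qed.

End polar.

(** Positivity in the order of [K] already forces [e] to be real. *)
Lemma scalar_01 (R : realType) (k : scalar_kind) (e : scalar_field R k) : 0 < e < 1 ->
  exists2 a : R, e = scalar_of k a & 0 < a < 1.
Proof.
move=> /andP[e0 e1]; have eE : e = scalar_of k (modulus e).
  by rewrite -modulusE gtr0_norm.
exists (modulus e) => //.
by rewrite -!(scalar_of_lt k) scalar_of0 scalar_of1 -eE e0 e1.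
Qed.

Theorem corollary1p7 (R : realType) (k : scalar_kind) (d : measure_display)
    (T : measurableType d) (mu : {measure set T -> \bar R}) :
  BPBp_nu_compact (Linfty k mu).
Proof.
move=> _ /scalar_01[e -> e01]; have [e0 e1] := andP e01.
have [eta /andP[eta0 eta1] core] := nonnegative_BPBp_nu k mu e01.
exists (scalar_of k eta).
  by rewrite -(scalar_of0 R k) -(scalar_of1 R k) !scalar_of_lt eta0 eta1.
move=> S0 x x' cS0 xx' nuS0 x'S0.
have [x1 x'1 x'x] := norming_pairsE xx'.
have [C C0 S0C] := compact_operator_bounded cS0.
(* The numerical radius bounds the norm; compactness has supplied the a priori bound [C]. *)
have S01 : opbounded_by S0 1.
  apply: opbounded_by_numerical_radius C0 S0C _ => z f zf.
  rewrite -(scalar_of_le k) -modulusE scalar_of1.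
  by apply: (supremum1_ub nuS0); exists (z, f).
have [m [mb [m1 mb1 mmb mbx]]] := polar x.
have mK u : Lmul m (Lmul mb u) = u by rewrite LmulA mmb Lmul1.
have mbK u : Lmul mb (Lmul m u) = u by rewrite LmulA (LmulC mb) mmb Lmul1.
have [s s1 sE] := scalar_phase (x' (S0 x) : scalar_field R k).
have s0 := modulus1_neq0 s1.
(* Conjugation by the isometry [Lmul m] turns [x] into a nonnegative function, and [s] makes the
   value to be tested a nonnegative real. *)
have linT : linear (fun u => s *: Lmul mb (S0 (Lmul m u)) : Linfty k mu).
  move=> a u v; rewrite [Lmul m _]linearP [S0 _]linearP [Lmul mb _]linearP.
  by rewrite scalerDr !scalerA (mulrC s).
have [T0 T0E] := to_linear linT.
have linpsi : linear (fun u => x' (Lmul m u)).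
  by move=> a u v; rewrite [Lmul m _]linearP [x' _]linearP.
have [psi psiE] := to_linear linpsi.
have T0S0 u : S0 u = s^-1 *: Lmul m (T0 (Lmul mb u)).
  by rewrite T0E mK LmulZr mK scalerA mulVf// scale1r.
have cT0 : compact_operator T0.
  have -> : compact_operator T0 = compact_map (fun u => s *: Lmul mb (S0 (Lmul m u))).
    by congr (precompact (_ @` _)); exact/funext.
  exact: compact_map_Lmul.
have T01 : opbounded_by T0 1.
  move=> u; rewrite T0E nrmZ s1 mul1r (le_trans (nrmM1 _ mb1))//.
  by rewrite (le_trans (S01 _))// ler_wpM2l// nrmM1.
have psi1 : bounded_by psi 1.
  by move=> u; rewrite psiE (le_trans (x'1 _))// ler_wpM2l// nrmM1.
have psix : psi (Lmul mb x) = 1 by rewrite psiE mK x'x.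
have psiT0 : 1 - eta <= scalar_re (psi (T0 (Lmul mb x)) : scalar_field R k).
  rewrite psiE T0E mK LmulZr mK [x' _]linearZ -[X in scalar_re X]/(_ * _) sE.
  rewrite scalar_re_of -(scalar_of_le k) scalar_ofB scalar_of1 -modulusE.
  exact: ltW.
have mbx1 : nrm (Lmul mb x) <= 1 by rewrite -x1 nrmM1.
have [S [y [psi' [cS S1 [y1 psi'1 psi'y psi'Sy] TS [xy pp]]]]] :=
  core T0 (Lmul mb x) psi cT0 T01 mbx mbx1 psi1 psix psiT0.
(* The conjugation and the phase are undone. *)
have linS : linear (fun u => s^-1 *: Lmul m (S (Lmul mb u)) : Linfty k mu).
  move=> a u v; rewrite [Lmul mb _]linearP [S _]linearP [Lmul m _]linearP.
  by rewrite scalerDr !scalerA (mulrC s^-1).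
have [S' S'E] := to_linear linS.
have liny : linear (fun u => psi' (Lmul mb u)).
  by move=> a u v; rewrite [Lmul mb _]linearP [psi' _]linearP.
have [y' y'E] := to_linear liny.
have sV1 : modulus s^-1 = 1 by rewrite modulusV s1 invr1.
have S'1 : opbounded_by S' 1.
  move=> u; rewrite S'E nrmZ sV1 mul1r (le_trans (nrmM1 _ m1))//.
  by rewrite (le_trans (S1 _))// ler_wpM2l// nrmM1.
have yy' : norming_pairs (Lmul m y, y').
  apply: norming_pairsI; first by rewrite (le_trans (nrmM1 _ m1)).
    by move=> u; rewrite y'E (le_trans (psi'1 _))// ler_wpM2l// nrmM1.
  by rewrite y'E mbK.
have y'S'y : `|y' (S' (Lmul m y))| = 1.
  rewrite y'E S'E mbK LmulZr mbK [psi' _]linearZ psi'Sy.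
  by rewrite -[X in `|X|]/(s^-1 * 1) mulr1 modulusE sV1 scalar_of1.
(* The estimates obtained are non-strict and pass to suprema as such; the factor 1/2 restores strict
   inequalities. *)
have half_lt : scalar_of k (e / 2) < scalar_of k e.
  by rewrite scalar_of_lt ltr_pdivrMr// ltr_pMr// ltr1n.
have e20 : 0 <= e / 2 by rewrite divr_ge0// ltW.
exists S', (Lmul m y), y'; split=> //.
- have -> : compact_operator S' = compact_map (fun u => s^-1 *: Lmul m (S (Lmul mb u))).
    by congr (precompact (_ @` _)); exact/funext.
  exact: compact_map_Lmul.
- split=> //; apply: supremum_max1; first by exists (Lmul m y, y').
  move=> _ [[z f] /norming_pairsE[z1 f1 _] <-] /=.
  rewrite -[`|_|]/(`|f (S' z) : scalar_field R k|) modulusE -(scalar_of1 R k) scalar_of_le.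
  apply: bounded_by_ball => //; rewrite (le_trans (S'1 _))// z1 mul1r//.
- apply: le_lt_trans half_lt; apply: op_norm_le => u.
  rewrite -(scalar_of1 R k) nrm_le_ball => u1.
  rewrite -[(_ \- _) u]/(S0 u - S' u) nrm_le_ball T0S0 S'E -scalerBr nrmZ sV1 mul1r.
  rewrite -LmulBr (le_trans (nrmM1 _ m1))// (le_trans (TS _))//.
  by rewrite ler_piMr// (le_trans (nrmM1 _ mb1)).
- split.
    apply: le_lt_trans half_lt; rewrite nrm_le_ball -(mK x) -LmulBr.
    by rewrite (le_trans (nrmM1 _ m1)).
  apply: le_lt_trans half_lt; apply: op_norm_le => u.
  rewrite -(scalar_of1 R k) nrm_le_ball => u1.
  rewrite -[X in `|X|]/((x' u : scalar_field R k) - y' u) modulusE scalar_of_le.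
  rewrite y'E -(mK u) mbK -[x' _]psiE (le_trans (pp _))//.
  by rewrite ler_piMr// (le_trans (nrmM1 _ mb1)).
Qed.
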